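(* Let $(a,b)\in\mathbb{R}^2$ with $a<b$, let $f\in L^1([a,b];\mathbb{R})$ and let $\alpha>0$. Then $$\mathcal{D}_b^\alpha\left(S_b^\alpha f\right)(x)=-f(x),\quad \text{for a.e. } x\in[a,b].$$
   Context: Let $E_1(x)=\int_x^\infty \frac{e^{-t}}{t}\,dt$ for $x>0$ and $\mathcal{S}(t)=e^{-t}\int_0^\infty \frac{t^{s-1}}{\Gamma(s)}\,ds$ for $t>0$, where $\Gamma$ is the Gamma function. For $\alpha>0$ and $f\in L^1([a,b];\mathbb{R})$, define for a.e. $x\in[a,b]$ $$(J_b^\alpha f)(x)=\frac{1}{\alpha}\int_x^b E_1\left(\frac{t-x}{\alpha}\right)f(t)\,dt,\qquad (S_b^\alpha f)(x)=\int_x^b \mathcal{S}\left(\frac{t-x}{\alpha}\right)f(t)\,dt.$$ A function in $L^1([a,b];\mathbb{R})$ has an absolutely continuous representative if it coincides a.e. on $[a,b]$ with an absolutely continuous function on $[a,b]$; it is then identified with that function. If $J_b^\alpha f$ has an absolutely continuous representative, the right-sided fractional derivative of order $\alpha$ of $f$ is $(\mathcal{D}_b^\alpha f)(x)=\frac{d}{dx}(J_b^\alpha f)(x)$ for a.e. $x\in[a,b]$. *)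

(* Defs.v *)
From HB Require Import structures.
From mathcomp Require Import all_boot all_order all_algebra.
From mathcomp Require Import all_classical all_reals all_analysis.

Set Implicit Arguments.
Unset Strict Implicit.
Unset Printing Implicit Defensive.

Import Order.TTheory GRing.Theory Num.Theory.
Import numFieldNormedType.Exports.

Local Open Scope classical_set_scope.
Local Open Scope ring_scope.

Definition L1 (R : realType) (a b : R) (f : R -> R) : Prop :=
  (@lebesgue_measure R).-integrable `[a, b] (EFin \o f).

Definition ae_on (R : realType) (a b : R) (P : R -> Prop) : Prop :=
  {ae (@lebesgue_measure R), forall x, x \in `[a, b] -> P x}.

Definition Gamma (R : realType) (s : R) : R :=
  (\int[@lebesgue_measure R]_(t in `]0%R, +oo[) (t `^ (s - 1) * expR (- t)))%R.

Definition E1 (R : realType) (x : R) : R :=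
  (\int[@lebesgue_measure R]_(t in `[x, +oo[) (expR (- t) / t))%R.

Definition calS (R : realType) (t : R) : R :=
  expR (- t) *
  (\int[@lebesgue_measure R]_(s in `]0%R, +oo[) (t `^ (s - 1) / Gamma s))%R.

(* [Rintegral] takes a junk value where the integrand is not integrable; for
   [f] in L^1([a, b]) this concerns only a null set of [x] in [frac_J]
   and [frac_S], where these operators are not defined mathematically. *)
Definition frac_J (R : realType) (b alpha : R) (f : R -> R) (x : R) : R :=
  alpha^-1 *
  (\int[@lebesgue_measure R]_(t in `[x, b]) (E1 ((t - x) / alpha) * f t))%R.

Definition frac_S (R : realType) (b alpha : R) (f : R -> R) (x : R) : R :=
  (\int[@lebesgue_measure R]_(t in `[x, b]) (calS ((t - x) / alpha) * f t))%R.

Definition absolutely_continuous (R : realType) (a b : R) (F : R -> R) : Prop :=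
  forall e : R, 0 < e -> exists2 d : R, 0 < d &
    forall (n : nat) (u v : 'I_n -> R),
      (forall i, a <= u i /\ u i <= v i /\ v i <= b) ->
      trivIset [set: 'I_n] (fun i => `]u i, v i[%classic) ->
      \sum_(i < n) (v i - u i) < d ->
      \sum_(i < n) `|F (v i) - F (u i)| < e.

Definition is_ac_repr (R : realType) (a b : R) (g F : R -> R) : Prop :=
  absolutely_continuous a b F /\ ae_on a b (fun x => g x = F x).

Definition has_ac_repr (R : realType) (a b : R) (g : R -> R) : Prop :=
  exists F : R -> R, is_ac_repr a b g F.

(* A chosen absolutely continuous representative, or [g] if there is none.  Two
   representatives agree on [a, b], so that its derivative on ]a, b[ does not
   depend on the choice. *)
Definition ac_repr (R : realType) (a b : R) (g : R -> R) : R -> R :=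
  xget g [set F | is_ac_repr a b g F].

Definition frac_derivable (R : realType) (a b alpha : R) (g : R -> R) : Prop :=
  L1 a b g /\ has_ac_repr a b (frac_J b alpha g).

Definition frac_deriv (R : realType) (a b alpha : R) (g : R -> R) : R -> R :=
  derive1 (ac_repr a b (frac_J b alpha g)).

(* Main.v *)
Require Import Defs.
From HB Require Import structures.
From mathcomp Require Import all_boot all_order all_algebra.
From mathcomp Require Import all_classical all_reals all_analysis.
From mathcomp Require Import measurable_realfun ring lra.
Import Order.TTheory GRing.Theory Num.Theory.
Import numFieldNormedType.Exports.
Local Open Scope classical_set_scope.
Local Open Scope ring_scope.

(** With g_s(t) = t^(s-1) e^(-t) / Gamma(s) the density of the gamma law of parameter
    s > 0, one has S = \int_0^oo g_s ds and g_r * g_s = g_(r+s).  For r > 0 the tail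
    T_r of t^(r-1) e^(-t) satisfies (T_r * g_s)(x) = Gamma(r) (F_s(x) - F_(r+s)(x)), where
    F_s is the distribution function of g_s; integrating over s gives
    (T_r * S)(x) = Gamma(r) \int_0^r F_s(x) ds.  As r tends to 0 the left side tends to
    (E1 * S)(x), by dominated convergence, and the right side to 1, because Gamma(r) ~ 1/r
    and F_s(x) -> 1.  The Sonine identity E1 * S = 1 so obtained and Fubini's theorem give
    J_b (S_b f) (x) = \int_x^b f, which is absolutely continuous and has derivative - f
    almost everywhere. *)

(** * Affine substitution *)

Section affine.
Context {R : realType}.
Notation mu := (@lebesgue_measure R).
Local Open Scope ereal_scope.

(** E1 is the tail T_0 of e^(-t)/t, which is not integrable at 0 and cannot be normalized to a
    probability density; this is why the identity is reached from parameters r > 0. Three obstacles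
    shape the argument. The difference of the integrals of F_s and F_(r+s) over s needs both to be
    finite, which follows from the bound F_s(x) <= e^x 2^(-s). The limit in r needs a domination: by
    Tonelli (T_r * S)(x) is the integral of t^(r-1) e^(-t) W(t), where W(t) is the S-mass of ]x - t,
    x]; now r occurs only in a power of t, bounded by the sum of its values at two end exponents.
    One of these exponents is 0 itself, where integrability is not known beforehand; Fatou's lemma
    gives it from the bound Gamma(r) r = Gamma(r+1) <= 2. Markov's inequality F_s(x) >= 1 - s/x
    makes the final limit a squeeze. Up to this point S takes values in [0, +oo] and only
    nonnegative integrals occur; the real-valued kernels, with their default values at infinite
    integrals, enter once S is known to be finite almost everywhere. *)

Lemma ge0_integral_oppr (f : R -> \bar R) :
  measurable_fun [set: R] f -> (forall x, 0 <= f x) ->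
  \int[mu]_x f (- x)%R = \int[mu]_x f x.
Proof.
move=> mf f0.
rewrite -[in RHS](@eq_measure_integral _ _ _ _ mu (pushforward mu (-%R : _ -> measurableTypeR R))).
  rewrite ge0_integral_pushforward//=.
by move=> A mA _; exact: lebesgue_measureN.
Qed.

(** By uniqueness of Lebesgue measure it suffices to test half-open intervals: the preimage of one
    is shorter by the factor [c], which the scaling restores. *)
Lemma lebesgue_measure_affine (c d : R) (A : set R) : (0 < c)%R -> measurable A ->
  c%:E * pushforward mu ((fun x => c * x + d)%R : _ -> measurableTypeR R) A = mu A.
Proof.
move=> c0 mA.
have mphi : measurable_fun [set: measurableTypeR R] ((fun x => c * x + d)%R : _ -> measurableTypeR R).
  by apply: measurable_funD => //; exact: measurable_funM.
pose m := mscale (NngNum (ltW c0))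
  (measure_function_pushforward__canonical__measure_function_Measure mu mphi).
suff: mu A = m A by move=> ->.
apply: lebesgue_measure_unique => //= _ [[p q]] _ <-.
rewrite /m /mscale/= /pushforward.
have -> : ((fun x : R => c * x + d)%R @^-1` `]p, q]) = `]((p - d) / c)%R, ((q - d) / c)%R]%classic.
  apply/seteqP; split=> x /=; rewrite !in_itv/= ltr_pdivrMr// ler_pdivlMr//.
    by rewrite ltrBlDr lerBrDr mulrC.
  by rewrite ltrBlDr lerBrDr mulrC.
rewrite !lebesgue_measure_itv/= !lte_fin ltr_pM2r ?invr_gt0// ltrD2r.
case: ifPn => // _; last by rewrite mule0.
rewrite -!EFinD -EFinM; congr EFin; field.
by rewrite gt_eqF.
Qed.

Lemma ge0_integral_affine (c d : R) (f : R -> \bar R) : (0 < c)%R ->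
  measurable_fun [set: R] f -> (forall x, 0 <= f x) ->
  c%:E * \int[mu]_x f (c * x + d)%R = \int[mu]_x f x.
Proof.
move=> c0 mf f0.
have mphi : measurable_fun [set: measurableTypeR R] ((fun x => c * x + d)%R : _ -> measurableTypeR R).
  by apply: measurable_funD => //; exact: measurable_funM.
pose m := mscale (NngNum (ltW c0))
  (measure_function_pushforward__canonical__measure_function_Measure mu mphi).
rewrite -[in RHS](@eq_measure_integral _ _ _ _ mu m); last first.
  by move=> A mA _; exact: lebesgue_measure_affine.
by rewrite /m ge0_integral_mscale//= ge0_integral_pushforward.
Qed.

Lemma ge0_integral_rev (d : R) (f : R -> \bar R) :
  measurable_fun [set: R] f -> (forall x, 0 <= f x) ->
  \int[mu]_x f (d - x)%R = \int[mu]_x f x.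
Proof.
move=> mf f0.
rewrite -(ge0_integral_oppr (fun x => f (d - x)%R))//; last first.
  by apply: measurableT_comp => //; exact: measurable_funB.
rewrite -[RHS](@ge0_integral_affine 1 d)// mul1e.
by apply: eq_integral => x _; rewrite opprK mul1r addrC.
Qed.

End affine.

(** * The gamma function *)

Section gamma_kernel.
Context {R : realType}.
Notation mu := (@lebesgue_measure R).

(* t^(s-1) e^(-t) on t > 0, in a form that is jointly measurable in (s, t). *)
Definition gker (s t : R) : R :=
  if 0 < t then expR ((s - 1) * ln t - t) else 0.

Lemma gker_ge0 s t : 0 <= gker s t.
Proof. by rewrite /gker; case: ifP => // _; exact: expR_ge0. Qed.

Lemma measurable_fun_gker d (T : measurableType d) (f g : T -> R) :
  measurable_fun [set: T] f -> measurable_fun [set: T] g ->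
  measurable_fun [set: T] (fun x => gker (f x) (g x)).
Proof.
move=> mf mg; apply: measurable_fun_ifT => //.
  exact: measurable_fun_ltr.
apply: measurableT_comp => //.
apply: measurable_funB => //; apply: measurable_funM.
  exact: measurable_funB.
exact: measurableT_comp.
Qed.

Lemma integral_gkerE s :
  (\int[mu]_(t in `]0%R, +oo[) (t `^ (s - 1) * expR (- t))%:E =
   \int[mu]_t (gker s t)%:E)%E.
Proof.
rewrite integral_mkcond; apply: eq_integral => t _.
rewrite patchE /gker mem_setE in_itv/= andbT; case: ifPn => // t0.
by rewrite /powR gt_eqF// expRD.
Qed.

Lemma ge0_integral_EFinZl d (T : measurableType d) (m : {measure set T -> \bar R})
  (D : set T) (k : R) (f : T -> R) : measurable D -> measurable_fun D f ->
  (forall x, D x -> 0 <= f x) -> 0 <= k ->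
  (\int[m]_(x in D) (k * f x)%:E = k%:E * \int[m]_(x in D) (f x)%:E)%E.
Proof.
move=> mD mf f0 k0; rewrite -ge0_integralZl ?lee_fin//; exact/measurable_EFinP.
Qed.

Lemma expR_continuousM (c : R) : continuous (fun t : R => expR (- (c * t))).
Proof.
move=> t; apply: (@continuous_comp _ _ _ (fun t : R => - (c * t)) expR).
  by apply: continuousN; exact: mulrl_continuous.
exact: continuous_expR.
Qed.


Lemma is_derive_expRM (c t : R) :
  is_derive t 1 (fun t : R => - (expR (- (c * t)) / c)) (expR (- (c * t)) * (c / c)).
Proof.
apply: is_derive_eq.
by rewrite scaler0 add0r /GRing.scale/= mulr1; ring.
Qed.

Lemma cvg_expRM_pinfty (c : R) : 0 < c -> expR (- (c * t)) @[t --> +oo] --> (0 : R).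
Proof.
move=> c0.
apply: (@cvg_comp _ _ _ (fun t : R => c * t) (fun t : R => expR (- t)) _ +oo).
  apply/cvgryPge => A; near=> t.
  rewrite mulrC -ler_pdivrMr//; near: t; exact: nbhs_pinfty_ge.
exact: cvgr_expR.
Unshelve. all: by end_near. Qed.

Lemma integral_expR_itvcy (c x : R) : 0 < c ->
  (\int[mu]_(t in `[x, +oo[) (expR (- (c * t)))%:E = (expR (- (c * x)) / c)%:E)%E.
Proof.
move=> c0.
rewrite (@ge0_continuous_FTC2y _ _ (fun t => - (expR (- (c * t)) / c)) _ 0).
- by rewrite sub0e EFinN oppeK.
- by move=> t _; exact: expR_ge0.
- by apply: continuous_subspaceT; exact: expR_continuousM.
- rewrite -oppr0 -(mul0r c^-1); apply: cvgN; apply: cvgMl; exact: cvg_expRM_pinfty.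
- by move=> t _; have [] := is_derive_expRM c t.
- apply: cvg_at_right_filter; apply: cvgN; apply: cvgMl; exact: expR_continuousM.
- by move=> t _; rewrite derive1E; have [_ ->] := is_derive_expRM c t; rewrite divff ?gt_eqF// mulr1.
Qed.

(** The integrand is t^(-(r+1)), with antiderivative - t^(-r) / r. This is where the factor 1/s of
    the functional equation of the gamma integral comes from. *)
Lemma integral_powR_itv1y (r : R) : 0 < r ->
  (\int[mu]_(t in `[1%R, +oo[) (expR (- (r + 1) * ln t))%:E = (r^-1)%:E)%E.
Proof.
move=> r0.
have d (t : R) : 0 < t -> is_derive t 1 (fun t : R => - (expR (- r * ln t) / r)) (expR (- (r + 1) * ln t)).
  move=> t0.
  have H := is_derive1_ln t0.
  apply: is_derive_eq.
  rewrite scaler0 add0r /GRing.scale/=.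
  rewrite (_ : - (r + 1) * ln t = - r * ln t - ln t); last by ring.
  by rewrite expRD [in RHS]expRN lnK ?posrE//; field; rewrite !gt_eqF.
have cv (q t : R) : 0 < t -> {for t, continuous (fun t : R => expR (q * ln t))}.
  move=> t0; apply: continuous_comp; last exact: continuous_expR.
  by apply: continuousM; [exact: cst_continuous|exact: continuous_ln].
rewrite (@ge0_continuous_FTC2y _ _ (fun t => - (expR (- r * ln t) / r)) _ 0).
- by rewrite ln1 mulr0 expR0 mul1r sub0e EFinN oppeK.
- by move=> t _; exact: expR_ge0.
- apply: continuous_in_subspaceT => t; rewrite inE/= in_itv/= andbT => t1.
  by apply: cv; rewrite (lt_le_trans _ t1).
- rewrite -oppr0 -(mul0r r^-1); apply: cvgN; apply: cvgMl.
  apply: (@cvg_comp _ _ _ (@ln R) (fun t : R => expR (- r * t)) _ +oo).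
    apply/cvgryPge => A; near=> t.
    have t0 : 0 < t by near: t; exact: nbhs_pinfty_gt.
    rewrite -ler_expR lnK ?posrE//; near: t; exact: nbhs_pinfty_ge.
  under eq_fun do rewrite mulNr.
  exact: cvg_expRM_pinfty.
- by move=> t t1; have [] := d t (lt_trans ltr01 t1).
- apply: cvg_at_right_filter; apply: cvgN; apply: cvgMl; exact: cv.
- by move=> t; rewrite in_itv/= andbT => t1; rewrite derive1E; have [_ ->] := d t (lt_trans ltr01 t1).
Unshelve. all: by end_near. Qed.

Local Notation G s := (\int[mu]_t (gker s t)%:E)%E.

Lemma measurable_gker s : measurable_fun [set: R] (EFin \o gker s).
Proof. by apply/measurable_EFinP; exact: measurable_fun_gker. Qed.

Lemma gker1 t : 0 < t -> gker 1 t = expR (- t).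
Proof. by move=> t0; rewrite /gker t0 subrr mul0r add0r. Qed.

Lemma integral_gker1 : G 1 = 1%E.
Proof.
transitivity (\int[mu]_(t in `]0%R, +oo[) (expR (- (1 * t)))%:E)%E.
  rewrite [RHS]integral_mkcond; apply: eq_integral => t _.
  rewrite patchE mem_setE in_itv/= andbT; case: ifPn => t0.
    by rewrite gker1// mul1r.
  by rewrite /gker (negbTE t0).
rewrite integral_itv_obnd_cbnd ?integral_expR_itvcy//.
  by rewrite mulr0 oppr0 expR0 divr1.
apply/measurable_EFinP; apply: measurable_funTS.
by apply: continuous_measurable_fun; exact: expR_continuousM.
Qed.

Lemma gkerS s t : gker (s + 1) t = t * gker s t.
Proof.
rewrite /gker; case: ifPn => t0; last by rewrite mulr0.
rewrite (_ : (s + 1 - 1) * ln t - t = ln t + ((s - 1) * ln t - t)); last by ring.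
by rewrite expRD lnK.
Qed.

(** The power is homogeneous and the exponential leaves the factor e^(-(l-1)t). It serves with a
    variable scale in the functional equation, with the scale of the convolution variable in the
    Beta integral, and with scale 2 in the decay of the distribution functions. *)
Lemma gker_scale s l t : 0 < l ->
  gker s (l * t) = expR ((s - 1) * ln l) * (gker s t * expR (- ((l - 1) * t))).
Proof.
move=> l0; rewrite /gker pmulr_rgt0//; case: ifPn => t0; last by rewrite mul0r mulr0.
by rewrite lnM// -!expRD; congr expR; ring.
Qed.

(* By integrating t^s e^(-l t) over t > 0 and l >= 1. *)
Lemma integral_gkerS s : 0 < s -> G s = ((s^-1)%:E * G (s + 1))%E.
Proof.
move=> s0.
(* At [z = (t, l)] this is t^s e^(-l t) for l >= 1. The integral over l is t^s e^(-t) / t =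
   [gker s t]; the integral over t is l^(-(s+1)) times [G (s + 1)]. By Tonelli the two agree in
   [0, +oo], before any finiteness of [G] is known. *)
pose K (z : R * R) := gker (s + 1) z.1 * (expR (- ((z.2 - 1) * z.1)) * \1_(`[1%R, +oo[%classic : set R) z.2).
have mK : measurable_fun [set: R * R] (EFin \o K).
  apply/measurable_EFinP; apply: measurable_funM.
    exact: measurable_fun_gker.
  apply: measurable_funM.
    apply: measurableT_comp => //; apply: measurable_funN; apply: measurable_funM => //.
    exact: measurable_funB.
  apply: measurableT_comp => //.
have K0 z : (0 <= (EFin \o K) z)%E.
  by rewrite /= lee_fin mulr_ge0 ?gker_ge0// mulr_ge0 ?expR_ge0.
have := fubini_tonelli (m1 := mu) (m2 := mu) (EFin \o K) mK K0.
under eq_integral => t _.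
  rewrite (_ : (\int[mu]_y _)%E = (gker s t)%:E); last first.
    have [t0|t0] := ltP 0 t; last first.
      rewrite integral0_eq; last first.
        by move=> y _; rewrite /K/= /gker ltNge t0/= mul0r.
      by rewrite /gker ltNge t0.
    transitivity (\int[mu]_(y in `[1%R, +oo[) (gker (s + 1) t * expR t * expR (- (t * y)))%:E)%E.
      rewrite [RHS]integral_mkcond; apply: eq_integral => y _.
      rewrite patchE /K/= indicE; case: ifPn => y1.
        by rewrite mulr1 -mulrA -expRD; congr (_ * expR _)%:E; ring.
      by rewrite !mulr0.
    rewrite ge0_integral_EFinZl//; last 2 first.
    - apply: measurable_funTS.
      by apply: continuous_measurable_fun; exact: expR_continuousM.
    - by rewrite mulr_ge0 ?gker_ge0 ?expR_ge0.
    rewrite integral_expR_itvcy// mulr1 -EFinM gkerS expRN; congr EFin.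
    by field; rewrite !gt_eqF ?expR_gt0.
  over.
move=> ->.
transitivity (\int[mu]_(l in `[1%R, +oo[) ((expR (- (s + 1) * ln l))%:E * G (s + 1)))%E.
  rewrite [RHS]integral_mkcond; apply: eq_integral => l _.
  rewrite patchE; case: ifPn => l1; last first.
    by rewrite integral0_eq// => t _; rewrite /K/= indicE (negbTE l1) !mulr0.
  have l0 : 0 < l by move: l1; rewrite inE/= in_itv/= andbT; exact: lt_le_trans.
  have -> : (\int[mu]_x (EFin \o K) (x, l) =
    \int[mu]_t (expR (- s * ln l) * gker (s + 1) (l * t + 0))%:E)%E.
    apply: eq_integral => t _; rewrite /K/= indicE l1 mulr1 addr0 gker_scale//.
    have E : - s * ln l + (s + 1 - 1) * ln l = 0 by ring.
    by rewrite mulrA -expRD E expR0 mul1r.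
  rewrite ge0_integral_EFinZl//; last 2 first.
  - apply: measurable_fun_gker => //.
    by apply: measurable_funD => //; exact: measurable_funM.
  - by move=> x _; exact: gker_ge0.
  rewrite -(@ge0_integral_affine _ l 0 (EFin \o gker (s + 1)))//; last 2 first.
  - exact: measurable_gker.
  - by move=> x; rewrite lee_fin gker_ge0.
  rewrite muleA -EFinM; congr (_%:E * _)%E.
  rewrite (_ : - (s + 1) * ln l = - s * ln l - ln l); last by ring.
  by rewrite expRD (expRN (ln l)) lnK ?posrE// mulfVK ?gt_eqF.
rewrite ge0_integralZr//.
- by rewrite integral_powR_itv1y.
- apply/measurable_EFinP; apply: measurable_funTS.
  by apply: measurableT_comp => //; apply: measurable_funM.
- by apply: integral_ge0 => x _; rewrite lee_fin gker_ge0.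
Qed.

(** The power t^(s-1) increases in s for t >= 1 and decreases for t < 1, so one of the end exponents
    dominates. This is the source of all dominating functions below. *)
Lemma gker_le s p q t : p <= s -> s <= q -> gker s t <= gker p t + gker q t.
Proof.
move=> ps sq; rewrite /gker; case: ifPn => t0; last by rewrite addr0.
have [t1|t1] := leP 1 t.
  apply: (@le_trans _ _ (expR ((q - 1) * ln t - t))); last by rewrite lerDr expR_ge0.
  by rewrite ler_expR lerD2r; apply: ler_wpM2r; rewrite ?ln_ge0 ?lerD2r.
apply: (@le_trans _ _ (expR ((p - 1) * ln t - t))); last by rewrite lerDl expR_ge0.
by rewrite ler_expR lerD2r; apply: ler_wnM2r; [exact/ln_le0/ltW|rewrite lerD2r].
Qed.

Lemma integral_gker_nat n : (G n.+1%:R < +oo)%E.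
Proof.
elim: n => [|n ih]; first by rewrite integral_gker1 ltry.
have : (G n.+1%:R < +oo)%E by [].
rewrite integral_gkerS ?ltr0n// natr1.
(* The functional equation is read backwards: an infinite integral at n + 2 would force an infinite
   one at n + 1. *)
rewrite !ltey; apply: contra => /eqP ->.
by rewrite gt0_muley// lte_fin invr_gt0 ltr0n.
Qed.

(** For an exponent at least 1, [gker_le] interpolates between 1 and an integer; a smaller positive
    one is raised by 1 through the functional equation. *)
Lemma integral_gker_lty s : 0 < s -> (G s < +oo)%E.
Proof.
have ge1 q : 1 <= q -> (G q < +oo)%E.
  move=> q1.
  have [n qn] : exists n, q <= n.+1%:R.
    by exists (Num.truncn q); rewrite ltW// truncnS_gt.
  apply: (@le_lt_trans _ _ (G 1 + G n.+1%:R)%E); last first.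
    by apply: lte_add_pinfty; [rewrite integral_gker1 ltry|exact: integral_gker_nat].
  rewrite -ge0_integralD//; last 4 first.
  - by move=> x _; rewrite lee_fin gker_ge0.
  - exact: measurable_gker.
  - by move=> x _; rewrite lee_fin gker_ge0.
  - exact: measurable_gker.
  apply: ge0_le_integral => //.
  - by move=> x _; rewrite lee_fin gker_ge0.
  - exact: measurable_gker.
  - by apply: emeasurable_funD; exact: measurable_gker.
  - by move=> x _; rewrite -EFinD lee_fin; exact: gker_le.
move=> s0; rewrite integral_gkerS//.
by rewrite lte_mul_pinfty ?lee_fin ?invr_ge0 ?ltW// ge1// lerDr ltW.
Qed.

Lemma integral_gkerE_Gamma s : 0 < s -> G s = (Gamma s)%:E.
Proof.
move=> s0; rewrite /Gamma /Rintegral integral_gkerE fineK// ge0_fin_numE.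
  exact: integral_gker_lty.
by apply: integral_ge0 => x _; rewrite lee_fin gker_ge0.
Qed.

Lemma Gamma1 : Gamma (1 : R) = 1.
Proof. by apply: EFin_inj; rewrite -integral_gkerE_Gamma// integral_gker1. Qed.

Lemma GammaS (s : R) : 0 < s -> Gamma (s + 1) = s * Gamma s.
Proof.
move=> s0; apply: EFin_inj; rewrite EFinM -!integral_gkerE_Gamma ?addr_gt0//.
by rewrite (integral_gkerS s)// muleA -EFinM mulfV ?gt_eqF// mul1e.
Qed.

(** On t >= 1 the integrand t^s e^(-t) is at least e^(-t), whose integral there is e^(-1). The bound
    makes [Gamma] positive, so that division by it is legitimate. *)
Lemma expRN1_le_GammaS (s : R) : 0 <= s -> expR (- 1) <= Gamma (s + 1).
Proof.
move=> s0; rewrite -lee_fin -integral_gkerE_Gamma ?ltr_wpDl//.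
have := integral_expR_itvcy 1 1 ltr01; rewrite mul1r divr1 => <-.
rewrite integral_mkcond; apply: ge0_le_integral => //.
- by move=> t _; rewrite patchE; case: ifPn => // _; rewrite lee_fin expR_ge0.
- apply/(measurable_restrictT _ _).1 => //; apply/measurable_EFinP.
  by apply: measurable_funTS; apply: continuous_measurable_fun; exact: expR_continuousM.
- exact: measurable_gker.
- move=> t _; rewrite patchE; case: ifPn => [|_]; last by rewrite lee_fin gker_ge0.
  rewrite inE/= in_itv/= andbT => t1; rewrite lee_fin /gker (lt_le_trans ltr01 t1).
  by rewrite ler_expR mul1r addrK lerDr mulr_ge0// ln_ge0.
Qed.

Lemma Gamma_gt0 (s : R) : 0 < s -> 0 < Gamma s.
Proof.
move=> s0; rewrite -(pmulr_rgt0 _ s0) -GammaS//.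
by rewrite (lt_le_trans (expR_gt0 (- 1)))// expRN1_le_GammaS// ltW.
Qed.

End gamma_kernel.

(** * Convolution of gamma kernels and the Beta integral *)

Section gamma_convolution.
Context {R : realType}.
Notation mu := (@lebesgue_measure R).
Lemma mule_EFin_eq (X : \bar R) (g p : R) : g != 0 ->
  (X * g%:E = p%:E)%E -> X = (p / g)%:E.
Proof.
move=> g0 XE; rewrite EFinM -XE -muleA -EFinM mulfV// mule1//.
Qed.

(* The Beta integral is evaluated by integrating the convolution over all T. *)
Lemma integral_gker_conv r s T : 0 < r -> 0 < s ->
  (\int[mu]_u (gker r (T - u) * gker s u)%:E =
   (Gamma r * Gamma s / Gamma (r + s) * gker (r + s) T)%:E)%E.
Proof.
move=> r0 s0.
(* On ]0, 1[ the exponentials multiply to e^(-1), so [expR 1 * beta] is Euler's Beta(r, s). *)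
pose beta := (\int[mu]_v (gker r (1 - v) * gker s v)%:E)%E.
have mK : measurable_fun [set: R * R] (fun z : R * R => (gker r (z.1 - z.2) * gker s z.2)%:E).
  by apply/measurable_EFinP; apply: measurable_funM; apply: measurable_fun_gker => //;
    exact: measurable_funB.
have mKr t : measurable_fun [set: R] (fun u : R => gker r (t - u) * gker s u).
  by apply: measurable_funM; apply: measurable_fun_gker => //;
    exact: measurable_funB.
have mK1 t : measurable_fun [set: R] (fun u : R => (gker r (t - u) * gker s u)%:E).
  exact/measurable_EFinP.
have K0 t u : (0 <= (gker r (t - u) * gker s u)%:E)%E.
  by rewrite lee_fin mulr_ge0 ?gker_ge0.
have convE t : (\int[mu]_u (gker r (t - u) * gker s u)%:E =
    (expR 1)%:E * beta * (gker (r + s) t)%:E)%E.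
  have [t0|t0] := ltP 0 t; last first.
    rewrite integral0_eq; last first.
      move=> u _; rewrite /gker; have [u0|u0] := ltP 0 u; last by rewrite mulr0.
      by rewrite ltNge subr_le0 (le_trans t0 (ltW u0))/= mul0r.
    by rewrite /gker ltNge t0 mule0.
  (* With u = t v, [gker_scale] extracts t^(r+s-2) e^(-(t-1)); the Jacobian t turns this into e
     times [gker (r + s) t]. *)
  rewrite -(@ge0_integral_affine _ t 0 (fun u => (gker r (t - u) * gker s u)%:E))//.
  transitivity (t%:E * \int[mu]_v (expR ((r + s - 2) * ln t - (t - 1)) *
     (gker r (1 - v) * gker s v))%:E)%E.
    congr (_ * _)%E; apply: eq_integral => v _; congr EFin.
    rewrite addr0 (_ : t - t * v = t * (1 - v)); last by ring.
    have -> : expR ((r + s - 2) * ln t - (t - 1)) =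
        expR ((r - 1) * ln t) * expR (- ((t - 1) * (1 - v))) *
        (expR ((s - 1) * ln t) * expR (- ((t - 1) * v))).
      by rewrite -!expRD; congr expR; ring.
    by rewrite !gker_scale//; ring.
  rewrite ge0_integral_EFinZl//; last 2 first.
  - exact: mKr.
  - by move=> v _; rewrite mulr_ge0 ?gker_ge0.
  rewrite -/beta muleA [RHS]muleAC -!EFinM /gker t0; congr (_%:E * _)%E.
  rewrite -[X in X * _](@lnK _ t)// -!expRD; congr expR; ring.
have b0 : (0 <= beta)%E by apply: integral_ge0 => x _; exact: K0.
have : ((expR 1)%:E * beta * (Gamma (r + s))%:E = (Gamma r * Gamma s)%:E)%E.
  rewrite -integral_gkerE_Gamma ?addr_gt0// -ge0_integralZl//; last 3 first.
  - exact: measurable_gker.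
  - by move=> x _; rewrite lee_fin gker_ge0.
  - by rewrite mule_ge0// lee_fin expR_ge0.
  under eq_integral do rewrite -convE.
  rewrite (fubini_tonelli (m1 := mu) (m2 := mu) (fun z : R * R => (gker r (z.1 - z.2) * gker s z.2)%:E))//=.
  transitivity (\int[mu]_u ((Gamma r)%:E * (gker s u)%:E))%E; last first.
    rewrite ge0_integralZl//.
    - by rewrite EFinM (integral_gkerE_Gamma s s0).
    - exact: measurable_gker.
    - by move=> x _; rewrite lee_fin gker_ge0.
    - by rewrite lee_fin ltW// Gamma_gt0.
  apply: eq_integral => u _.
  under eq_integral do rewrite mulrC.
  rewrite ge0_integral_EFinZl//; last 3 first.
  - by apply: measurable_fun_gker => //; exact: measurable_funB.
  - by move=> x _; exact: gker_ge0.
  - exact: gker_ge0.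
  rewrite muleC -(integral_gkerE_Gamma r r0); congr (_ * _)%E.
  rewrite -[RHS](@ge0_integral_affine _ 1 (- u) (EFin \o gker r))//.
  - by rewrite mul1e; apply: eq_integral => x _ /=; rewrite mul1r.
  - exact: measurable_gker.
  - by move=> x; rewrite lee_fin gker_ge0.
move/mule_EFin_eq => bE.
by rewrite convE bE ?gt_eqF ?Gamma_gt0 ?addr_gt0.
Qed.
End gamma_convolution.

(** * Gamma distributions *)

Section gamma_density.
Context {R : realType}.
Notation mu := (@lebesgue_measure R).

Lemma measurable_fun_natb d (T : measurableType d) (b : T -> bool) :
  measurable_fun [set: T] b -> measurable_fun [set: T] (fun x => (b x)%:R : R).
Proof.
move=> mb; rewrite (_ : (fun x => _) = (fun x => if b x then 1 else 0)).
  exact: measurable_fun_ifT.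
by apply/funext => x; case: (b x).
Qed.

Lemma measurable_Gamma : measurable_fun [set: R] (@Gamma R).
Proof.
rewrite (_ : @Gamma R = fine \o (fun s => \int[mu]_t (gker s t)%:E)%E); last first.
  by apply/funext => s /=; rewrite /Gamma /Rintegral integral_gkerE.
apply: measurableT_comp; first exact: fine_measurable.
apply: (measurable_fun_fubini_tonelli_F (m2 := mu) (fun z : R * R => (gker z.1 z.2)%:E)).
  by apply/measurable_EFinP; exact: measurable_fun_gker.
by move=> z; rewrite lee_fin gker_ge0.
Qed.

(** The value 0 for [s <= 0] lets integrals in the parameter run over the whole line, where Tonelli
    and the affine substitutions are applied. *)
Definition gdens (s u : R) : R := if 0 < s then gker s u / Gamma s else 0.

Lemma gdens_ge0 s u : 0 <= gdens s u.
Proof.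
rewrite /gdens; case: ifPn => // s0.
by rewrite divr_ge0 ?gker_ge0// ltW// Gamma_gt0.
Qed.

Lemma measurable_fun_gdens d (T : measurableType d) (f g : T -> R) :
  measurable_fun [set: T] f -> measurable_fun [set: T] g ->
  measurable_fun [set: T] (fun x => gdens (f x) (g x)).
Proof.
move=> mf mg; apply: measurable_fun_ifT => //; first exact: measurable_fun_ltr.
apply: measurable_funM; first exact: measurable_fun_gker.
(* The inverse becomes a real power, known to be measurable. The two agree because [Gamma] is
   nonnegative at every argument, default value included. *)
rewrite (_ : (fun x => _) = (fun x => (Gamma (f x)) `^ (-1))); last first.
  apply/funext => x; rewrite /Gamma powR_inv1// Rintegral_ge0// => t _.
  by rewrite mulr_ge0 ?powR_ge0 ?expR_ge0.
have mG := measurableT_comp measurable_Gamma mf.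
exact: (@measurableT_comp _ _ _ _ _ _ (fun x : R => x `^ (-1)) _ (Gamma (R := R) \o f)).
Qed.

Lemma measurable_gdens s : measurable_fun [set: R] (EFin \o gdens s).
Proof. by apply/measurable_EFinP; exact: measurable_fun_gdens. Qed.

Lemma integral_gdens s : 0 < s -> (\int[mu]_u (gdens s u)%:E = 1)%E.
Proof.
move=> s0; transitivity (\int[mu]_u ((Gamma s)^-1 * gker s u)%:E)%E.
  by apply: eq_integral => u _; rewrite /gdens s0 mulrC.
rewrite ge0_integral_EFinZl//; last 3 first.
- exact: measurable_fun_gker.
- by move=> x _; exact: gker_ge0.
- by rewrite invr_ge0 ltW// Gamma_gt0.
by rewrite (integral_gkerE_Gamma s s0) -EFinM mulVf// gt_eqF// Gamma_gt0.
Qed.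

Lemma integral_gker_gdens r s T : 0 < r -> 0 < s ->
  (\int[mu]_u (gker r (T - u) * gdens s u)%:E = (Gamma r * gdens (r + s) T)%:E)%E.
Proof.
move=> r0 s0.
transitivity (\int[mu]_u ((Gamma s)^-1 * (gker r (T - u) * gker s u))%:E)%E.
  by apply: eq_integral => u _; rewrite /gdens s0; congr EFin; ring.
rewrite ge0_integral_EFinZl//; last 3 first.
- by apply: measurable_funM; apply: measurable_fun_gker => //; exact: measurable_funB.
- by move=> x _; rewrite mulr_ge0 ?gker_ge0.
- by rewrite invr_ge0 ltW// Gamma_gt0.
rewrite integral_gker_conv// -EFinM /gdens addr_gt0//; congr EFin.
have := lt0r_neq0 (Gamma_gt0 _ s0); have := lt0r_neq0 (Gamma_gt0 _ (addr_gt0 r0 s0)).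
by move: (Gamma r) (Gamma s) (Gamma (r + s)) => x y z z0 y0; field; rewrite z0 y0.
Qed.

Definition gcdf (s T : R) : \bar R := (\int[mu]_v (gdens s v * (v <= T)%R%:R)%:E)%E.

Lemma gcdf_le0 s T : s <= 0 -> gcdf s T = 0%E.
Proof.
by move=> s0; apply: integral0_eq => v _; rewrite /gdens ltNge s0 mul0r.
Qed.

Lemma gcdf_ge0 s T : (0 <= gcdf s T)%E.
Proof. by apply: integral_ge0 => v _; rewrite lee_fin mulr_ge0 ?gdens_ge0. Qed.

Lemma measurable_fun_gcdf_int d (S : measurableType d) (f g h : S -> R) :
  measurable_fun [set: S] f -> measurable_fun [set: S] g -> measurable_fun [set: S] h ->
  measurable_fun [set: S] (fun z => gdens (f z) (g z) * (g z <= h z)%R%:R).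
Proof.
move=> mf mg mh; apply: measurable_funM; first exact: measurable_fun_gdens.
by apply: measurable_fun_natb; exact: measurable_fun_ler.
Qed.

Lemma measurable_gcdf T : measurable_fun [set: R] (gcdf ^~ T).
Proof.
apply: (measurable_fun_fubini_tonelli_F (m2 := mu) (fun z : R * R => (gdens z.1 z.2 * (z.2 <= T)%R%:R)%:E)).
  by apply/measurable_EFinP; exact: measurable_fun_gcdf_int.
by move=> z; rewrite lee_fin mulr_ge0 ?gdens_ge0.
Qed.

Lemma gcdf_le1 s T : (gcdf s T <= 1)%E.
Proof.
have [s0|s0] := ltP 0 s; last by rewrite gcdf_le0.
rewrite -(integral_gdens s s0); apply: ge0_le_integral => //.
- by move=> v _; rewrite lee_fin mulr_ge0 ?gdens_ge0.
- by apply/measurable_EFinP; exact: measurable_fun_gcdf_int.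
- exact: measurable_gdens.
- by move=> v _; rewrite lee_fin; case: (v <= T); rewrite ?mulr1// mulr0 gdens_ge0.
Qed.

(* Markov's inequality, the gamma distribution of parameter s having mean s. *)
Lemma gcdf_ge s T : 0 < s -> 0 < T -> (1 <= gcdf s T + (s / T)%:E)%E.
Proof.
move=> s0 T0.
(* Size biasing: v g_s(v) = s g_(s+1)(v). Thus (s/T) g_(s+1)(v) = (v/T) g_s(v), which dominates
   g_s(v) exactly on v >= T, the part missing from [gcdf s T]. *)
have -> : (s / T)%:E = (\int[mu]_v ((s / T) * gdens (s + 1) v)%:E)%E.
  rewrite ge0_integral_EFinZl//; last 3 first.
  - exact: measurable_fun_gdens.
  - by move=> x _; exact: gdens_ge0.
  - by rewrite divr_ge0// ltW.
  by rewrite integral_gdens ?addr_gt0// mule1.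
rewrite -(integral_gdens s s0) -ge0_integralD//; last 4 first.
- by move=> v _; rewrite lee_fin mulr_ge0 ?gdens_ge0.
- by apply/measurable_EFinP; exact: measurable_fun_gcdf_int.
- by move=> v _; rewrite lee_fin mulr_ge0 ?gdens_ge0// divr_ge0// ltW.
- by apply/measurable_EFinP; apply: measurable_funM => //; exact: measurable_fun_gdens.
apply: ge0_le_integral => //.
- by move=> v _; rewrite lee_fin gdens_ge0.
- exact: measurable_gdens.
- apply: emeasurable_funD; apply/measurable_EFinP; first exact: measurable_fun_gcdf_int.
  by apply: measurable_funM => //; exact: measurable_fun_gdens.
- move=> v _; rewrite -EFinD lee_fin; have [vT|Tv] := leP v T.
    by rewrite mulr1 lerDl mulr_ge0 ?gdens_ge0// divr_ge0// ltW.
  rewrite mulr0 add0r /gdens s0 addr_gt0// gkerS GammaS//.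
  have -> : s / T * (v * gker s v / (s * Gamma s)) = v / T * (gker s v / Gamma s).
    have := lt0r_neq0 (Gamma_gt0 _ s0).
    by move: (Gamma s) => x x0; field; rewrite x0 !gt_eqF.
  apply: ler_peMl; last by rewrite ler_pdivlMr// mul1r ltW.
  by rewrite divr_ge0 ?gker_ge0// ltW// Gamma_gt0.
Qed.

(* Doubling the variable compares g_s(2v) with 2^(s-1) e^(-v) g_s(v). *)
Lemma gcdf_le_expR s T : 0 < s -> (gcdf s T <= (expR (T - s * ln 2))%:E)%E.
Proof.
move=> s0.
have : (2%:E * \int[mu]_v (gdens s (2 * v + 0))%:E = 1)%E.
  rewrite (@ge0_integral_affine _ 2 0 (EFin \o gdens s))//.
  - exact: integral_gdens.
  - exact: measurable_gdens.
  - by move=> v; rewrite lee_fin gdens_ge0.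
(* Only v <= T is kept, where e^(-v) >= e^(-T). For fixed [T] the outcome is a decay like 2^(-s),
   integrable in s. *)
have : ((expR ((s - 1) * ln 2 - T))%:E * gcdf s T <= \int[mu]_v (gdens s (2 * v + 0))%:E)%E.
  rewrite -ge0_integral_EFinZl//; last 2 first.
  - exact: measurable_fun_gcdf_int.
  - by move=> v _; rewrite mulr_ge0 ?gdens_ge0.
  apply: ge0_le_integral => //.
  - by move=> v _; rewrite lee_fin mulr_ge0// mulr_ge0 ?gdens_ge0.
  - by apply/measurable_EFinP; apply: measurable_funM => //; exact: measurable_fun_gcdf_int.
  - apply/measurable_EFinP; apply: measurable_fun_gdens => //.
    by apply: measurable_funD => //; exact: measurable_funM.
  - move=> v _; rewrite lee_fin; have [vT|Tv] := leP v T; last by rewrite !mulr0 gdens_ge0.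
    rewrite mulr1 addr0 /gdens s0 mulrA ler_pM2r ?invr_gt0 ?Gamma_gt0// gker_scale//.
    rewrite expRD -mulrA ler_pM2l ?expR_gt0// mulrC ler_wpM2l ?gker_ge0// ler_expR lerN2.
    by rewrite (_ : (2 - 1) * v = v)//; ring.
move=> h1 h2; have : (2%:E * ((expR ((s - 1) * ln 2 - T))%:E * gcdf s T) <= 1)%E.
  by rewrite -h2 lee_pmul2l.
rewrite muleA -EFinM muleC -lee_pdivlMr ?mul1e//; last by rewrite mulr_gt0 ?expR_gt0.
move=> /le_trans; apply; rewrite lee_fin.
rewrite (_ : 2 * _ = expR (s * ln 2 - T)); last first.
  by rewrite -[X in X * _](@lnK _ 2) ?posrE// -expRD; congr expR; ring.
by rewrite -expRN ler_expR; lra.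
Qed.

End gamma_density.

(** * Mixture of the gamma distributions *)

Section volterra_density.
Context {R : realType}.
Notation mu := (@lebesgue_measure R).
Local Open Scope ereal_scope.

(* calS as an extended real; finite for almost every u. *)
Definition vdens (u : R) : \bar R := \int[mu]_s (gdens s u)%:E.

Lemma measurable_gdens2 : measurable_fun [set: R * R] (fun z : R * R => (gdens z.2 z.1)%:E).
Proof. by apply/measurable_EFinP; exact: measurable_fun_gdens. Qed.

Lemma vdens_ge0 u : 0 <= vdens u.
Proof. by apply: integral_ge0 => s _; rewrite lee_fin gdens_ge0. Qed.

Lemma measurable_vdens : measurable_fun [set: R] vdens.
Proof.
apply: (measurable_fun_fubini_tonelli_F (m2 := mu) (fun z : R * R => (gdens z.2 z.1)%:E)).
  exact: measurable_gdens2.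
by move=> z; rewrite lee_fin gdens_ge0.
Qed.

Lemma ge0_integral_vdensM (h : R -> \bar R) :
  measurable_fun [set: R] h -> (forall u, 0 <= h u) ->
  \int[mu]_u (vdens u * h u) = \int[mu]_s \int[mu]_u ((gdens s u)%:E * h u).
Proof.
move=> mh h0.
rewrite -(fubini_tonelli (m1 := mu) (m2 := mu) (fun z : R * R => ((gdens z.2 z.1)%:E * h z.1)))/=.
- apply: eq_integral => u _; rewrite ge0_integralZr//.
  + by apply/measurable_EFinP; exact: measurable_fun_gdens.
  + by move=> s _; rewrite lee_fin gdens_ge0.
- apply: emeasurable_funM; first exact: measurable_gdens2.
  exact: measurableT_comp.
- by move=> z; rewrite mule_ge0// lee_fin gdens_ge0.
Qed.

(** The event u <= T < u + y. For fixed u it selects the tail y > T - u, as in [gtail]; for fixed y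
    it selects the window T - y < u <= T, as in [vtail]. *)
Definition tailset (T u y : R) : bool := (u <= T)%R && (T - u < y)%R.

Lemma measurable_fun_tailset d (S : measurableType d) (T : R) (f g : S -> R) :
  measurable_fun [set: S] f -> measurable_fun [set: S] g ->
  measurable_fun [set: S] (fun z => (tailset T (f z) (g z))%:R : R).
Proof.
move=> mf mg; apply: measurable_fun_natb; apply: measurable_and.
  exact: measurable_fun_ler.
by apply: measurable_fun_ltr => //; exact: measurable_funB.
Qed.

Definition gtail (r T u : R) : \bar R :=
  \int[mu]_y (gker r y * (tailset T u y)%:R)%:E.

Lemma gtail_ge0 r T u : 0 <= gtail r T u.
Proof. by apply: integral_ge0 => y _; rewrite lee_fin mulr_ge0 ?gker_ge0. Qed.

Lemma measurable_gtail_int r T : measurable_fun [set: R * R]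
  (fun z : R * R => (gker r z.2 * (tailset T z.1 z.2)%:R)%:E).
Proof.
apply/measurable_EFinP; apply: measurable_funM; first exact: measurable_fun_gker.
exact: measurable_fun_tailset.
Qed.

Lemma measurable_gtail r T : measurable_fun [set: R] (gtail r T).
Proof.
apply: (measurable_fun_fubini_tonelli_F (m2 := mu) _ (measurable_gtail_int r T)).
by move=> z; rewrite lee_fin mulr_ge0 ?gker_ge0.
Qed.

(** The S-mass of ]T - y, T]. It does not depend on r, so the limit in r will concern only the
    weight [gker r y]. *)
Definition vtail (T y : R) : \bar R :=
  \int[mu]_u (vdens u * ((tailset T u y)%:R)%:E).

Lemma measurable_vtail_int T : measurable_fun [set: R * R]
  (fun z : R * R => vdens z.1 * ((tailset T z.1 z.2)%:R)%:E).
Proof.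
apply: emeasurable_funM; first by apply: measurableT_comp => //; exact: measurable_vdens.
by apply/measurable_EFinP; exact: measurable_fun_tailset.
Qed.

Lemma vtail_ge0 T y : 0 <= vtail T y.
Proof. by apply: integral_ge0 => u _; rewrite mule_ge0 ?vdens_ge0// lee_fin. Qed.

Lemma measurable_vtail T : measurable_fun [set: R] (vtail T).
Proof.
apply: (measurable_fun_fubini_tonelli_G (m1 := mu) _ (measurable_vtail_int T)).
by move=> z; rewrite mule_ge0 ?vdens_ge0// lee_fin.
Qed.

Lemma integral_gker_vtail r T :
  \int[mu]_y ((gker r y)%:E * vtail T y) = \int[mu]_u (vdens u * gtail r T u).
Proof.
have mv y : measurable_fun [set: R] (fun u => vdens u * ((tailset T u y)%:R)%:E).
  apply: emeasurable_funM; first exact: measurable_vdens.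
  by apply/measurable_EFinP; exact: measurable_fun_tailset.
have mg u : measurable_fun [set: R] (fun y => (gker r y)%:E * ((tailset T u y)%:R)%:E).
  apply: emeasurable_funM; first exact: measurable_gker.
  by apply/measurable_EFinP; exact: measurable_fun_tailset.
transitivity (\int[mu]_y \int[mu]_u ((gker r y)%:E * (vdens u * ((tailset T u y)%:R)%:E))).
  apply: eq_integral => y _; rewrite ge0_integralZl//.
  - exact: mv.
  - by move=> u _; rewrite mule_ge0 ?vdens_ge0// lee_fin.
  - by rewrite lee_fin gker_ge0.
rewrite -(fubini_tonelli (m1 := mu) (m2 := mu)
  (fun z : R * R => (gker r z.2)%:E * (vdens z.1 * ((tailset T z.1 z.2)%:R)%:E)))/=.
- apply: eq_integral => u _.
  under eq_integral do rewrite muleCA.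
  rewrite ge0_integralZl ?vdens_ge0//.
  + exact: mg.
  + by move=> y _; rewrite mule_ge0// lee_fin// gker_ge0.
- apply: emeasurable_funM; last exact: measurable_vtail_int.
  by apply/measurable_EFinP; exact: measurable_fun_gker.
- by move=> z; rewrite !mule_ge0 ?vdens_ge0// lee_fin ?gker_ge0.
Qed.

(* P(X <= T < X + Y) + P(X + Y <= T) = P(X <= T) for independent gamma variables X, Y
   of parameters s, r, multiplied by Gamma(r). *)
Lemma gtail_split r s T : (0 < r)%R -> (0 < s)%R ->
  \int[mu]_u ((gdens s u)%:E * gtail r T u) + (Gamma r)%:E * gcdf (r + s) T =
  (Gamma r)%:E * gcdf s T.
Proof.
move=> r0 s0.
(* In the coordinates (X, X + Y) this is Gamma(r) times the joint density, cut to X + Y <= T.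
   Integrating X out gives [gcdf (r + s)] by convolution; keeping X outside and shifting back to Y
   gives a term comparable with [gtail]. *)
pose K (z : R * R) := (gdens s z.1 * (gker r (z.2 - z.1) * (z.2 <= T)%R%:R))%:E.
have K0 z : 0 <= K z by rewrite lee_fin mulr_ge0 ?gdens_ge0// mulr_ge0 ?gker_ge0.
have mKr : measurable_fun [set: R * R] (fun z : R * R => gker r (z.2 - z.1) * (z.2 <= T)%R%:R)%R.
  apply: measurable_funM.
    by apply: measurable_fun_gker => //; exact: measurable_funB.
  by apply: measurable_fun_natb; exact: measurable_fun_ler.
have mK : measurable_fun [set: R * R] K.
  by apply/measurable_EFinP; apply: measurable_funM => //; exact: measurable_fun_gdens.
transitivity (\int[mu]_u ((gdens s u)%:E * gtail r T u) + \int[mu]_u \int[mu]_v K (u, v)).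
  congr (_ + _).
  rewrite (fubini_tonelli (m1 := mu) (m2 := mu) K mK K0).
  rewrite /gcdf.
  rewrite -ge0_integral_EFinZl//; last 3 first.
  - exact: measurable_fun_gcdf_int.
  - by move=> v _; rewrite mulr_ge0 ?gdens_ge0.
  - by rewrite ltW// Gamma_gt0.
  apply: eq_integral => v _.
  transitivity (\int[mu]_u ((v <= T)%R%:R * (gker r (v - u) * gdens s u))%:E).
    rewrite ge0_integral_EFinZl//; last 2 first.
    - by apply: measurable_funM; [apply: measurable_fun_gker => //; exact: measurable_funB|exact: measurable_fun_gdens].
    - by move=> u _; rewrite mulr_ge0 ?gker_ge0 ?gdens_ge0.
    by rewrite integral_gker_gdens// -EFinM; congr EFin; ring.
  by apply: eq_integral => u _; congr EFin; rewrite /=; ring.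
have mh : measurable_fun [set: R] (fun u => \int[mu]_v K (u, v)).
  exact: (measurable_fun_fubini_tonelli_F (m2 := mu) _ mK).
rewrite -ge0_integralD//; last 3 first.
- by move=> u _; rewrite mule_ge0 ?gtail_ge0// lee_fin gdens_ge0.
- by apply: emeasurable_funM; [exact: measurable_gdens|exact: measurable_gtail].
- by move=> u _; exact: integral_ge0.
rewrite /gcdf -ge0_integral_EFinZl//; last 3 first.
- exact: measurable_fun_gcdf_int.
- by move=> v _; rewrite mulr_ge0 ?gdens_ge0.
- by rewrite ltW// Gamma_gt0.
apply: eq_integral => u _.
have -> : \int[mu]_v K (u, v) =
    (gdens s u)%:E * \int[mu]_y (gker r y * (y + u <= T)%R%:R)%:E.
  rewrite /K/= ge0_integral_EFinZl ?gdens_ge0//; last 2 first.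
  - exact: (measurable_fun_pair2 (f := fun z : R * R => gker r (z.2 - z.1) * (z.2 <= T)%R%:R)%R).
  - by move=> v _; rewrite mulr_ge0 ?gker_ge0.
  congr (_ * _).
  rewrite -[RHS](@ge0_integral_affine _ 1 (- u) (fun y => (gker r y * (y + u <= T)%R%:R)%:E))//.
  - rewrite mul1e; apply: eq_integral => v _.
    by rewrite mul1r subrK.
  - apply/measurable_EFinP; apply: measurable_funM; first exact: measurable_fun_gker.
    by apply: measurable_fun_natb; apply: measurable_fun_ler => //; exact: measurable_funD.
  - by move=> y; rewrite lee_fin mulr_ge0 ?gker_ge0.
rewrite -ge0_muleDr ?gtail_ge0//; last first.
  by apply: integral_ge0 => y _; rewrite lee_fin mulr_ge0 ?gker_ge0.
rewrite /gtail -ge0_integralD//; last 4 first.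
- by move=> y _; rewrite lee_fin mulr_ge0 ?gker_ge0.
- by apply/measurable_EFinP; apply: measurable_funM; [exact: measurable_fun_gker|exact: measurable_fun_tailset].
- by move=> y _; rewrite lee_fin mulr_ge0 ?gker_ge0.
- apply/measurable_EFinP; apply: measurable_funM; first exact: measurable_fun_gker.
  by apply: measurable_fun_natb; apply: measurable_fun_ler => //; exact: measurable_funD.
(* For y > 0 the events u <= T < u + y and u + y <= T partition u <= T; for y <= 0 the kernel
   vanishes. *)
transitivity ((gdens s u)%:E * \int[mu]_y ((u <= T)%R%:R * gker r y)%:E).
  congr (_ * _); apply: eq_integral => y _; rewrite -EFinD -mulrDr mulrC.
  have [y0|y0] := ltP 0%R y; last by rewrite /gker ltNge y0 !mulr0.
  congr (_ * _)%:E; rewrite /tailset -natrD; congr _%:R.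
  have [uT|Tu] := leP u T => /=.
    by rewrite -lerBrDr; case: ltP.
  by rewrite [(y + u <= T)%R]leNgt (lt_trans Tu)// ltrDr.
rewrite ge0_integral_EFinZl//; last 2 first.
- exact: measurable_fun_gker.
- by move=> y _; exact: gker_ge0.
by rewrite integral_gkerE_Gamma// -!EFinM; congr EFin; ring.
Qed.

(** The bound e^T 2^(-s) is integrable over s >= 0. By [integral_vdens] this makes the S-mass of
    ]-oo, T] finite, which gives finiteness of S almost everywhere and permits the cancellation in
    s. *)
Lemma integral_gcdf_lty T : \int[mu]_s gcdf s T < +oo.
Proof.
apply: (@le_lt_trans _ _ (\int[mu]_(s in `[0%R, +oo[) ((expR T)%:E * (expR (- (ln 2 * s)))%:E))).
  rewrite [leRHS]integral_mkcond; apply: ge0_le_integral => //.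
  - by move=> s _; exact: gcdf_ge0.
  - exact: measurable_gcdf.
  - apply/(measurable_restrictT _ _).1 => //; apply/measurable_EFinP/measurable_funTS.
    by apply: measurable_funM => //; apply: continuous_measurable_fun; exact: expR_continuousM.
  - move=> s _; rewrite patchE; case: ifPn => [|/negP s0].
      rewrite inE/= in_itv/= andbT => s0; move: s0; rewrite le_eqVlt => /orP[/eqP <-|s0].
        by rewrite gcdf_le0// lee_fin mulr_ge0 ?expR_ge0.
      rewrite -EFinM -expRD mulrC; exact: gcdf_le_expR.
    rewrite gcdf_le0// leNgt; apply/negP => s1; apply: s0.
    by rewrite inE/= in_itv/= andbT ltW.
have ln20 : (0 < ln (2 : R))%R by rewrite ln_gt0// ltr1n.
rewrite ge0_integralZl//.
- by rewrite integral_expR_itvcy// -EFinM ltry.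
- apply/measurable_EFinP/measurable_funTS.
  by apply: continuous_measurable_fun; exact: expR_continuousM.
Qed.

Lemma integral_vdens T :
  \int[mu]_u (vdens u * ((u <= T)%R%:R)%:E) = \int[mu]_s gcdf s T.
Proof.
rewrite ge0_integral_vdensM//.
by apply/measurable_EFinP; apply: measurable_fun_natb; exact: measurable_fun_ler.
Qed.

(** As [gcdf s T] vanishes for [s <= 0], this is the integral of F_s(T) over 0 < s <= r. *)
Definition icdf (r T : R) : \bar R := \int[mu]_s (gcdf s T * ((s <= r)%R%:R)%:E).

Lemma measurable_icdf_int r T : measurable_fun [set: R] (fun s => gcdf s T * ((s <= r)%R%:R)%:E).
Proof.
apply: emeasurable_funM; first exact: measurable_gcdf.
by apply/measurable_EFinP; apply: measurable_fun_natb; exact: measurable_fun_ler.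
Qed.

(** [gtail_split] is integrated over s > 0. The shift s -> r + s turns the second term into Gamma(r)
    times [P], the integral of F_s over s > r, so only 0 < s <= r survives. Instead of subtracting
    extended reals, Gamma(r) [P] is added to both sides and cancelled, being finite. *)
Lemma integral_gker_vtail_icdf r T : (0 < r)%R ->
  \int[mu]_y ((gker r y)%:E * vtail T y) = (Gamma r)%:E * icdf r T.
Proof.
move=> r0.
have G0 : 0 <= (Gamma r)%:E by rewrite lee_fin ltW// Gamma_gt0.
pose P := \int[mu]_s (gcdf s T * ((r < s)%R%:R)%:E).
have mP : measurable_fun [set: R] (fun s => gcdf s T * ((r < s)%R%:R)%:E).
  apply: emeasurable_funM; first exact: measurable_gcdf.
  by apply/measurable_EFinP; apply: measurable_fun_natb; exact: measurable_fun_ltr.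
have PQ : icdf r T + P = \int[mu]_s gcdf s T.
  rewrite -ge0_integralD//; last 3 first.
  - by move=> s _; rewrite mule_ge0 ?gcdf_ge0// lee_fin.
  - exact: measurable_icdf_int.
  - by move=> s _; rewrite mule_ge0 ?gcdf_ge0// lee_fin.
  apply: eq_integral => s _; have [sr|rs] := leP s r.
    by rewrite mule1 mule0 adde0.
  by rewrite mule1 mule0 add0e.
have P0 : 0 <= P by apply: integral_ge0 => s _; rewrite mule_ge0 ?gcdf_ge0// lee_fin.
have Q0 : 0 <= icdf r T by apply: integral_ge0 => s _; rewrite mule_ge0 ?gcdf_ge0// lee_fin.
have Pfin : P \is a fin_num.
  rewrite ge0_fin_numE// (le_lt_trans _ (integral_gcdf_lty T))// -PQ leeDr//.
rewrite integral_gker_vtail ge0_integral_vdensM; [|exact: measurable_gtail|exact: gtail_ge0].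
set X := (X in X = _).
suff : X + (Gamma r)%:E * P = (Gamma r)%:E * icdf r T + (Gamma r)%:E * P.
  move/(congr1 (fun x => x - (Gamma r)%:E * P)).
  by rewrite !addeK// fin_numM.
rewrite -ge0_muleDr// PQ.
have -> : P = \int[mu]_s (gcdf (r + s) T * ((0 < s)%R%:R)%:E).
  rewrite /P -(@ge0_integral_affine _ 1 r (fun s => gcdf s T * ((r < s)%R%:R)%:E))//.
    rewrite mul1e; apply: eq_integral => s _.
    by rewrite mul1r addrC ltrDl.
  by move=> s; rewrite mule_ge0 ?gcdf_ge0// lee_fin.
have mrs : measurable_fun [set: R] (fun s => gcdf (r + s) T * ((0 < s)%R%:R)%:E).
  apply: emeasurable_funM.
    apply: (measurableT_comp (f := gcdf ^~ T)); first exact: measurable_gcdf.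
    exact: measurable_funD.
  by apply/measurable_EFinP; apply: measurable_fun_natb; exact: measurable_fun_ltr.
transitivity (X + \int[mu]_s ((Gamma r)%:E * (gcdf (r + s) T * ((0 < s)%R%:R)%:E))).
  congr (_ + _); rewrite ge0_integralZl//.
  by move=> s _; rewrite mule_ge0 ?gcdf_ge0// lee_fin.
transitivity (\int[mu]_s ((Gamma r)%:E * gcdf s T)); last first.
  rewrite ge0_integralZl//; first exact: measurable_gcdf.
  by move=> s _; exact: gcdf_ge0.
have mgg : measurable_fun [set: R * R] (fun z : R * R => (gdens z.1 z.2)%:E * gtail r T z.2).
  apply: emeasurable_funM; last by apply: measurableT_comp => //; exact: measurable_gtail.
  by apply/measurable_EFinP; exact: measurable_fun_gdens.
rewrite -ge0_integralD//; last 4 first.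
- move=> s _; apply: integral_ge0 => u _.
  by rewrite mule_ge0 ?gtail_ge0// lee_fin gdens_ge0.
- apply: (measurable_fun_fubini_tonelli_F (m2 := mu) _ mgg) => z.
  by rewrite mule_ge0 ?gtail_ge0// lee_fin gdens_ge0.
- by move=> s _; rewrite !mule_ge0 ?gcdf_ge0// lee_fin.
- exact: measurable_funeM.
apply: eq_integral => s _; have [s0|s0] := ltP 0%R s.
  by rewrite mule1 gtail_split.
rewrite mule0 mule0 adde0 gcdf_le0// mule0 integral0_eq// => u _.
by rewrite /gdens ltNge s0 mul0e.
Qed.

Lemma integral_cst_itv0c (c r : R) : (0 <= r)%R ->
  \int[mu]_(s in `]0%R, r]) c%:E = (c * r)%:E.
Proof.
move=> r0; rewrite integral_cst//= lebesgue_measure_itv/= lte_fin.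
by move: r0; rewrite le_eqVlt => /orP[/eqP <-|r0]; rewrite ?ltxx ?mulr0 ?mule0// r0 oppr0 adde0.
Qed.

Lemma icdf_le r T : (0 <= r)%R -> icdf r T <= r%:E.
Proof.
move=> r0.
rewrite -[X in _ <= X%:E]mul1r -integral_cst_itv0c//.
rewrite [leRHS]integral_mkcond; apply: ge0_le_integral => //.
- by move=> s _; rewrite mule_ge0 ?gcdf_ge0// lee_fin.
- exact: measurable_icdf_int.
- by apply/(measurable_restrictT _ _).1.
- move=> s _; rewrite patchE mem_setE in_itv/=; have [s0|s0] := ltP 0%R s.
    by have [sr|sr] /= := leP s r; rewrite ?mule0// mule1 gcdf_le1.
  by rewrite gcdf_le0// mul0e.
Qed.

(** Markov's inequality gives F_s(T) >= 1 - s/T >= 1 - r/T on 0 < s <= r; the additive form avoids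
    subtraction in the extended reals. *)
Lemma icdf_ge r T : (0 <= r)%R -> (0 < T)%R -> r%:E <= icdf r T + (r / T * r)%:E.
Proof.
move=> r0 T0.
have E (c : R) : (c * r)%:E = \int[mu]_s ((fun=> c%:E) \_ `]0%R, r]) s.
  by rewrite -integral_mkcond integral_cst_itv0c.
have c0 : (0 <= r / T)%R by rewrite divr_ge0// ltW.
have m (c : R) : measurable_fun [set: R] ((fun=> c%:E) \_ `]0%R, r]).
  by apply/(measurable_restrictT _ _).1.
rewrite -[X in X%:E <= _]mul1r !E -ge0_integralD//; last 4 first.
- by move=> s _; rewrite mule_ge0 ?gcdf_ge0// lee_fin.
- exact: measurable_icdf_int.
- by move=> s _; rewrite patchE; case: ifPn => //; rewrite lee_fin.
- exact: m.
apply: ge0_le_integral => //.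
- by move=> s _; rewrite patchE; case: ifPn => //; rewrite lee_fin.
- exact: m.
- by apply: emeasurable_funD; [exact: measurable_icdf_int|exact: m].
- move=> s _; rewrite !patchE mem_setE in_itv/=; have [s0|s0] := ltP 0%R s; last first.
    by rewrite adde0 mule_ge0 ?gcdf_ge0// lee_fin.
  have [sr|sr] /= := leP s r; last by rewrite mule0 adde0.
  rewrite mule1 (le_trans (gcdf_ge _ _ s0 T0))// leeD2l// lee_fin.
  by rewrite ler_pM2r ?invr_gt0.
Qed.

(** The singularity of Gamma(r) at 0 is absorbed by the length of the s-interval: Gamma(r) r =
    Gamma(r + 1). *)
Lemma integral_gker_vtail_le r T : (0 < r)%R ->
  \int[mu]_y ((gker r y)%:E * vtail T y) <= (Gamma (r + 1))%:E.
Proof.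
move=> r0; rewrite integral_gker_vtail_icdf// GammaS// mulrC EFinM.
by rewrite lee_pmul2l ?lte_fin ?Gamma_gt0// icdf_le// ltW.
Qed.

Lemma integral_gker_vtail_ge r T : (0 < r)%R -> (0 < T)%R ->
  (Gamma (r + 1))%:E <=
    \int[mu]_y ((gker r y)%:E * vtail T y) + (Gamma (r + 1) * (r / T))%:E.
Proof.
move=> r0 T0; rewrite integral_gker_vtail_icdf// GammaS//.
have := icdf_ge r T (ltW r0) T0.
rewrite -(@lee_pmul2l _ (Gamma r)%:E) ?lte_fin ?Gamma_gt0// ge0_muleDr//; last 2 first.
- by apply: integral_ge0 => s _; rewrite mule_ge0 ?gcdf_ge0// lee_fin.
- by rewrite lee_fin mulr_ge0 ?divr_ge0// ltW.
rewrite -EFinM mulrC => /le_trans; apply.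
by rewrite leeD2l// lee_fin le_eqVlt; apply/orP; left; apply/eqP; ring.
Qed.

End volterra_density.

(** * Limit of small parameter *)

Section sonine.
Context {R : realType}.
Notation mu := (@lebesgue_measure R).
Local Open Scope ereal_scope.

Lemma cvg_gker (s_ : R^nat) (s y : R) : s_ @ \oo --> s ->
  gker (s_ n) y @[n --> \oo] --> gker s y.
Proof.
move=> ss; rewrite /gker; case: ifPn => y0; last exact: cvg_cst.
apply: (cvg_comp (fun n => ((s_ n - 1) * ln y - y)%R) expR); last exact: continuous_expR.
by apply: cvgB; [apply: cvgMl; apply: cvgB => //; exact: cvg_cst|exact: cvg_cst].
Qed.

Lemma cvg_gkerM (W : \bar R) (s_ : R^nat) (s y : R) : s_ @ \oo --> s -> W \is a fin_num ->
  (gker (s_ n) y)%:E * W @[n --> \oo] --> (gker s y)%:E * W.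
Proof.
move=> ss Wfin; apply: cvgeZr => //.
by apply: cvg_EFin; [exact: nearW|exact: cvg_gker].
Qed.

(** Dominated convergence, the dominating function being the sum of the integrands at [p] and [q]
    given by [gker_le]. Finiteness of [W] gives the pointwise limit of the products. *)
Lemma cvg_integral_gkerM (W : R -> \bar R) (p q : R) (s_ : R^nat) (s : R) :
  measurable_fun [set: R] W -> (forall y, 0 <= W y) -> (forall y, W y < +oo) ->
  (forall n, (p <= s_ n <= q)%R) -> s_ @ \oo --> s ->
  \int[mu]_y ((gker p y)%:E * W y) < +oo -> \int[mu]_y ((gker q y)%:E * W y) < +oo ->
  \int[mu]_y ((gker (s_ n) y)%:E * W y) @[n --> \oo] --> \int[mu]_y ((gker s y)%:E * W y).
Proof.
move=> mW W0 Wfin pq ss ip iq.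
have m r : measurable_fun [set: R] (fun y => (gker r y)%:E * W y).
  by apply: emeasurable_funM => //; exact: measurable_gker.
have ge0 r y : 0 <= (gker r y)%:E * W y by rewrite mule_ge0// lee_fin gker_ge0.
have int r : \int[mu]_y ((gker r y)%:E * W y) < +oo ->
    mu.-integrable setT (fun y => (gker r y)%:E * W y).
  move=> h; apply/integrableP; split; first exact: m.
  by under eq_integral do rewrite gee0_abs//.
have [] := @dominated_convergence _ _ _ mu setT measurableT
  (fun n y => (gker (s_ n) y)%:E * W y) (fun y => (gker s y)%:E * W y)
  (fun y => (gker p y)%:E * W y + (gker q y)%:E * W y); last by [].
- by move=> n; exact: m.
- exact: m.
- apply: aeW => y _; apply: cvg_gkerM => //.
  by rewrite ge0_fin_numE.
- by apply: integrableD => //; exact: int.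
- apply: aeW => y n _; rewrite gee0_abs// -ge0_muleDl ?lee_fin ?gker_ge0//.
  by rewrite lee_wpmul2r// -EFinD lee_fin; apply: gker_le; have /andP[] := pq n.
Qed.

(** The weight 1 on the exponents [1, 2]. Since Gamma(r + 1) = r Gamma(r), this is Gamma(r) ~ 1/r
    along r = 1/(n+1). *)
Lemma cvg_Gamma1 : Gamma (harmonic n + 1)%R @[n --> \oo] --> (1 : R)%R.
Proof.
have : \int[mu]_y ((gker (harmonic n + 1) y)%:E * cst 1 y) @[n --> \oo] -->
    \int[mu]_y ((gker (1 : R) y)%:E * cst 1 y).
  apply: (cvg_integral_gkerM _ 1 2) => //.
  - by move=> y; rewrite ltry.
  - by move=> n; rewrite lerDr invr_ge0 ler0n/= -lerBrDr (_ : 2 - 1 = 1)%R ?invf_le1 ?ler1n ?ltr0n//; ring.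
  - rewrite -[X in _ --> X]add0r; apply: cvgD; [exact: cvg_harmonic|exact: cvg_cst].
  - by under eq_integral do rewrite mule1; exact: integral_gker_lty.
  - by under eq_integral do rewrite mule1; exact: integral_gker_lty.
under eq_integral do rewrite mule1.
rewrite integral_gker1.
under eq_fun => n.
  under eq_integral do rewrite mule1.
  rewrite integral_gkerE_Gamma; last by rewrite addr_gt0 ?invr_gt0 ?ltr0n.
  over.
by move/fine_cvg.
Qed.

Lemma vtail_lty (T y : R) : vtail T y < +oo.
Proof.
apply: le_lt_trans (integral_gcdf_lty T).
rewrite -integral_vdens; apply: ge0_le_integral => //.
- by move=> u _; rewrite mule_ge0 ?vdens_ge0// lee_fin.
- apply: emeasurable_funM; first exact: measurable_vdens.
  by apply/measurable_EFinP; exact: measurable_fun_tailset.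
- apply: emeasurable_funM; first exact: measurable_vdens.
  by apply/measurable_EFinP; apply: measurable_fun_natb; exact: measurable_fun_ler.
- move=> u _; rewrite lee_wpmul2l ?vdens_ge0// lee_fin /tailset ler_nat.
  by case: (u <= T)%R => //=; case: (_ < _)%R.
Qed.

(** The constant is Gamma(1) + Gamma(2) = 1 + 1, from [gker_le] between the exponents 1 and 2. *)
Lemma Gamma_le2 (r : R) : (0 < r <= 1)%R -> (Gamma (r + 1) <= 2)%R.
Proof.
move=> /andP[r0 r1]; rewrite -lee_fin -integral_gkerE_Gamma ?addr_gt0//.
apply: (@le_trans _ _ (\int[mu]_t (gker 1 t + gker 2 t)%:E)).
  apply: ge0_le_integral => //.
  - by move=> t _; rewrite lee_fin gker_ge0.
  - exact: measurable_gker.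
  - by apply/measurable_EFinP; apply: measurable_funD; exact: measurable_fun_gker.
  - by move=> t _; rewrite lee_fin; apply: gker_le; lra.
under eq_integral do rewrite EFinD.
rewrite ge0_integralD//; last 4 first.
- by move=> t _; rewrite lee_fin gker_ge0.
- exact: measurable_gker.
- by move=> t _; rewrite lee_fin gker_ge0.
- exact: measurable_gker.
rewrite (_ : 2 = 1 + 1)%R// (integral_gkerE_Gamma (1 + 1)%R) ?addr_gt0// integral_gkerE_Gamma//.
by rewrite GammaS// Gamma1 mul1r.
Qed.

(** Domination down to r = 0 requires integrability at r = 0, out of reach of the formula containing
    Gamma(r). Fatou's lemma along r = 1/(n+1) provides it from the uniform bound Gamma(r + 1) <=
    2. *)
Lemma integral_gker0_vtail_le2 (T : R) : \int[mu]_y ((gker 0 y)%:E * vtail T y) <= 2%:E.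
Proof.
have m r : measurable_fun [set: R] (fun y => (gker r y)%:E * vtail T y).
  by apply: emeasurable_funM; [exact: measurable_gker|exact: measurable_vtail].
have ge0 r y : 0 <= (gker r y)%:E * vtail T y.
  by rewrite mule_ge0 ?vtail_ge0// lee_fin gker_ge0.
have h n : (0 < (harmonic n : R) <= 1)%R.
  by rewrite /= invr_gt0 ltr0n/= invf_le1 ?ler1n ?ltr0n.
have := fatou mu measurableT (fun n => m (harmonic n)) (fun n y _ => ge0 (harmonic n) y).
rewrite (_ : \int[mu]_y _ = \int[mu]_y ((gker 0 y)%:E * vtail T y)); last first.
  apply: eq_integral => y _; apply: (cvg_limn_einf_sup _).1.
  apply: cvg_gkerM; first exact: cvg_harmonic.
  by rewrite ge0_fin_numE ?vtail_ge0 ?vtail_lty.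
move=> /le_trans; apply.
rewrite limn_einf_lim; apply: lime_le; first exact: is_cvg_einfs.
apply: nearW => n; apply: (@le_trans _ _ (\int[mu]_y ((gker (harmonic n) y)%:E * vtail T y))).
  by apply: ereal_inf_lbound; exists n => /=.
have /andP[h0 h1] := h n.
apply: (le_trans (integral_gker_vtail_le _ T h0)).
by rewrite lee_fin Gamma_le2.
Qed.

Lemma integral_gker0_vtail (T : R) : (0 < T)%R -> \int[mu]_y ((gker 0 y)%:E * vtail T y) = 1.
Proof.
move=> T0.
have h n : (0 < (harmonic n : R) <= 1)%R.
  by rewrite /= invr_gt0 ltr0n/= invf_le1 ?ler1n ?ltr0n.
have cv : \int[mu]_y ((gker (harmonic n) y)%:E * vtail T y) @[n --> \oo] -->
    \int[mu]_y ((gker 0 y)%:E * vtail T y).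
  apply: (cvg_integral_gkerM _ 0 1).
  - exact: measurable_vtail.
  - exact: vtail_ge0.
  - exact: vtail_lty.
  - by move=> n; have /andP[h0 h1] := h n; rewrite h1 ltW.
  - exact: cvg_harmonic.
  - by rewrite (le_lt_trans (integral_gker0_vtail_le2 T))// ltry.
  - by rewrite (le_lt_trans (integral_gker_vtail_le _ T ltr01))// ltry.
suff : \int[mu]_y ((gker (harmonic n) y)%:E * vtail T y) @[n --> \oo] --> 1%:E.
  by move=> /(cvg_unique _ cv); apply; exact: ereal_hausdorff.
(* With r = 1/(n+1), the value lies between Gamma(r + 1) (1 - r/T) and Gamma(r + 1), both tending to
   1. *)
apply: (@squeeze_cvge _ _ _ _ (fun n => (Gamma (harmonic n + 1) * (1 - harmonic n / T))%:E) _
   (fun n => (Gamma (harmonic n + 1))%:E)).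
- apply: nearW => n; have /andP[h0 h1] := h n.
  rewrite integral_gker_vtail_le// andbT mulrBr mulr1 EFinB leeBlDr//.
  exact: integral_gker_vtail_ge.
- apply: cvg_EFin; first exact: nearW.
  rewrite -[X in _ --> X](mulr1 (1%R : R)); apply: cvgM; first exact: cvg_Gamma1.
  rewrite -[X in _ --> X]subr0; apply: cvgB; first exact: cvg_cst.
  by rewrite -(mul0r (T^-1)%R); apply: cvgMl; exact: cvg_harmonic.
- by apply: cvg_EFin; [exact: nearW|exact: cvg_Gamma1].
Qed.

End sonine.

(** * The Sonine identity *)

Section kernels.
Context {R : realType}.
Notation mu := (@lebesgue_measure R).

(** Extension by 0 to [z <= 0] turns the truncated integrals over [x, b] into convolutions on the
    whole line. *)
Definition kE1 (z : R) : R := if 0 < z then E1 z else 0.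
Definition kS (z : R) : R := if 0 < z then calS z else 0.

Lemma gker0 (y : R) : 0 < y -> gker 0 y = expR (- y) / y.
Proof.
move=> y0; rewrite /gker y0 (_ : (0 - 1) * ln y - y = - y - ln y); last by ring.
by rewrite expRD [X in _ * X]expRN lnK.
Qed.

Lemma measurable_E1_int z : measurable_fun [set: R] (fun y : R => gker 0 y * (z < y)%R%:R).
Proof.
apply: measurable_funM; first exact: measurable_fun_gker.
by apply: measurable_fun_natb; exact: measurable_fun_ltr.
Qed.

Lemma integral_E1E z : 0 < z ->
  (\int[mu]_(t in `[z, +oo[) (expR (- t) / t)%:E = \int[mu]_y (gker 0 y * (z < y)%R%:R)%:E)%E.
Proof.
move=> z0.
have E : (\int[mu]_(t in `]z, +oo[) (expR (- t) / t)%:E = \int[mu]_y (gker 0 y * (z < y)%R%:R)%:E)%E.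
  rewrite [LHS]integral_mkcond; apply: eq_integral => y _.
  rewrite patchE mem_setE in_itv/= andbT; case: ifPn => zy; last by rewrite mulr0.
  by rewrite mulr1 gker0// (lt_trans z0).
rewrite -integral_itv_obnd_cbnd//.
apply/measurable_EFinP.
apply: (eq_measurable_fun (fun y => gker 0 y * (z < y)%R%:R)).
  move=> y; rewrite inE/= in_itv/= andbT => zy.
  by rewrite zy mulr1 gker0// (lt_trans z0).
by apply: measurable_funTS; exact: measurable_E1_int.
Qed.

Lemma integral_E1_lty z : 0 < z -> (\int[mu]_y (gker 0 y * (z < y)%R%:R)%:E < +oo)%E.
Proof.
move=> z0.
apply: (@le_lt_trans _ _ (\int[mu]_y (z^-1 * gker 1 y)%:E)%E).
  apply: ge0_le_integral => //.
  - by move=> y _; rewrite lee_fin mulr_ge0 ?gker_ge0.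
  - by apply/measurable_EFinP; exact: measurable_E1_int.
  - by apply/measurable_EFinP; apply: measurable_funM => //; exact: measurable_fun_gker.
  - move=> y _; rewrite lee_fin; have [zy|_] := ltP z y; last by rewrite mulr0 mulr_ge0 ?gker_ge0// invr_ge0 ltW.
    have y0 := lt_trans z0 zy.
    rewrite mulr1 gker0// gker1// mulrC ler_wpM2r ?expR_ge0//.
    by rewrite lef_pV2 ?posrE// ltW.
rewrite ge0_integral_EFinZl//; last 3 first.
- exact: measurable_fun_gker.
- by move=> y _; exact: gker_ge0.
- by rewrite invr_ge0 ltW.
by rewrite integral_gker1 mule1 ltry.
Qed.

Lemma kE1E z : kE1 z = if 0 < z then fine (\int[mu]_y (gker 0 y * (z < y)%R%:R)%:E)%E else 0.
Proof. by rewrite /kE1; case: ifPn => // z0; rewrite /E1 /Rintegral integral_E1E. Qed.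

Lemma EFin_kE1 z : 0 < z -> ((kE1 z)%:E = \int[mu]_y (gker 0 y * (z < y)%R%:R)%:E)%E.
Proof.
move=> z0; rewrite kE1E z0 fineK// ge0_fin_numE ?integral_E1_lty//.
by apply: integral_ge0 => y _; rewrite lee_fin mulr_ge0 ?gker_ge0.
Qed.

Lemma kE1_ge0 z : 0 <= kE1 z.
Proof.
rewrite kE1E; case: ifPn => // _; apply: fine_ge0.
by apply: integral_ge0 => y _; rewrite lee_fin mulr_ge0 ?gker_ge0.
Qed.

Lemma measurable_kE1 : measurable_fun [set: R] kE1.
Proof.
rewrite (funext kE1E); apply: measurable_fun_ifT => //.
  exact: measurable_fun_ltr.
apply: measurableT_comp; first exact: fine_measurable.
apply: (measurable_fun_fubini_tonelli_F (m2 := mu) (fun z : R * R => (gker 0 z.2 * (z.1 < z.2)%R%:R)%:E)).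
  apply/measurable_EFinP; apply: measurable_funM; first exact: measurable_fun_gker.
  by apply: measurable_fun_natb; exact: measurable_fun_ltr.
by move=> z; rewrite lee_fin mulr_ge0 ?gker_ge0.
Qed.

Lemma kSE z : kS z = if 0 < z then fine (vdens z) else 0.
Proof.
rewrite /kS; case: ifPn => // z0; rewrite /calS /Rintegral.
have -> : vdens z = ((expR (- z))%:E * \int[mu]_(s in `]0%R, +oo[) (z `^ (s - 1) / Gamma s)%:E)%E.
  rewrite -ge0_integral_EFinZl//; last 2 first.
  - apply: (eq_measurable_fun (fun s => expR z * gdens s z)).
      move=> s; rewrite inE/= in_itv/= andbT => s0.
      by rewrite /gdens s0 /gker z0 /powR gt_eqF// mulrA -expRD subrKC.
    by apply: measurable_funTS; apply: measurable_funM => //; exact: measurable_fun_gdens.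
  - by move=> s /=; rewrite in_itv/= andbT => s0; rewrite divr_ge0 ?powR_ge0// ltW// Gamma_gt0.
  rewrite [RHS]integral_mkcond; apply: eq_integral => s _.
  rewrite patchE mem_setE in_itv/= andbT /gdens; case: ifPn => // s0.
  by rewrite /gker z0 /powR gt_eqF// addrC expRD mulrA.
(* [fine] commutes with the positive factor even at an infinite integral, where both sides take the
   default value 0. *)
by move: (integral _ _ _) => [x| |]/=; rewrite ?gt0_muley ?gt0_muleNy ?lte_fin ?expR_gt0// mulr0.
Qed.

Lemma kS_ge0 z : 0 <= kS z.
Proof. by rewrite kSE; case: ifPn => // _; apply: fine_ge0; exact: vdens_ge0. Qed.

Lemma measurable_kS : measurable_fun [set: R] kS.
Proof.
rewrite (funext kSE); apply: measurable_fun_ifT => //.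
  exact: measurable_fun_ltr.
by apply: measurableT_comp; [exact: fine_measurable|exact: measurable_vdens].
Qed.

Lemma vdens_le0 (u : R) : u <= 0 -> vdens u = 0%E.
Proof.
move=> u0; apply: integral0_eq => s _; rewrite /gdens /gker (ltNge 0 u) u0/= mul0r.
by case: ifP.
Qed.

(** An integrable function is finite almost everywhere, so [fine] in [kSE] loses nothing off a null
    set. *)
Lemma ae_kS_vdens (T : R) : {ae mu, forall u : R, u <= T -> (kS u)%:E = vdens u}.
Proof.
have : mu.-integrable setT (fun u => vdens u * ((u <= T)%R%:R)%:E)%E.
  apply/integrableP; split.
    apply: emeasurable_funM; first exact: measurable_vdens.
    by apply/measurable_EFinP; apply: measurable_fun_natb; exact: measurable_fun_ler.
  under eq_integral do rewrite gee0_abs ?mule_ge0 ?vdens_ge0 ?lee_fin//.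
  by rewrite integral_vdens; exact: integral_gcdf_lty.
move=> /integrable_ae => /(_ measurableT); apply: filterS => u /(_ I) + uT.
rewrite uT mule1 kSE => fin; case: ifPn => [_|]; first by rewrite fineK.
by rewrite -leNgt => u0; rewrite vdens_le0.
Qed.

Lemma integral_kS_lty T : (\int[mu]_u (kS u * (u <= T)%R%:R)%:E < +oo)%E.
Proof.
apply: le_lt_trans (integral_gcdf_lty T); rewrite -integral_vdens.
rewrite le_eqVlt; apply/orP; left; apply/eqP; apply: ge0_ae_eq_integral => //.
- apply/measurable_EFinP; apply: measurable_funM; first exact: measurable_kS.
  by apply: measurable_fun_natb; exact: measurable_fun_ler.
- apply: emeasurable_funM; first exact: measurable_vdens.
  by apply/measurable_EFinP; apply: measurable_fun_natb; exact: measurable_fun_ler.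
- by move=> u _; rewrite lee_fin mulr_ge0 ?kS_ge0.
- by move=> u _; rewrite mule_ge0 ?vdens_ge0// lee_fin.
- have := ae_kS_vdens T; apply: filterS; first exact: (ae_filter_ringOfSetsType mu).
  move=> u h _.
  by have [uT|Tu] := leP u T; rewrite ?mulr0 ?mule0// mulr1 mule1 h.
Qed.

Lemma integral_kE1_kS T : 0 < T -> (\int[mu]_u (kE1 (T - u) * kS u)%:E = 1)%E.
Proof.
move=> T0; rewrite -(integral_gker0_vtail T T0) integral_gker_vtail.
apply: ge0_ae_eq_integral => //.
- apply/measurable_EFinP; apply: measurable_funM; last exact: measurable_kS.
  apply: measurableT_comp; first exact: measurable_kE1.
  exact: measurable_funB.
- by apply: emeasurable_funM; [exact: measurable_vdens|exact: measurable_gtail].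
- by move=> u _; rewrite lee_fin mulr_ge0 ?kS_ge0 ?kE1_ge0.
- by move=> u _; rewrite mule_ge0 ?vdens_ge0 ?gtail_ge0.
(* At u = T the two sides differ in convention: [kE1 0] is 0, whereas [gtail 0 T T] is the divergent
   integral of e^(-y)/y over y > 0. *)
- have neT : {ae mu, forall u : R, u != T}.
    exists [set T]; split => //; first exact: lebesgue_measure_set1.
    by move=> u /= /negP; rewrite negbK => /eqP.
  apply: filterS2 (ae_kS_vdens T) neT; first exact: (ae_filter_ringOfSetsType mu).
  move=> u h uT _.
  move: uT; rewrite neq_lt => /orP[uT|Tu].
    rewrite EFinM h ?ltW// muleC; congr (_ * _)%E.
    rewrite EFin_kE1 ?subr_gt0//; apply: eq_integral => y _.
    by rewrite /tailset ltW.
  rewrite {1}/kE1 subr_gt0 ltNge (ltW Tu)/= mul0r /gtail integral0_eq ?mule0// => y _.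
  by rewrite /tailset leNgt Tu mulr0.
Qed.

(* By the substitution t = r - al u. *)
Lemma integral_kE1_kS_scaled (al x r : R) : 0 < al ->
  (\int[mu]_t (kE1 ((t - x) / al) * kS ((r - t) / al))%:E = (al * (x < r)%R%:R)%:E)%E.
Proof.
move=> al0.
pose k (t : R) := (kE1 ((t - x) / al) * kS ((r - t) / al))%:E.
have m : measurable_fun [set: R] k.
  apply/measurable_EFinP; apply: measurable_funM.
    apply: measurableT_comp; first exact: measurable_kE1.
    by apply: measurable_funM => //; exact: measurable_funB.
  apply: measurableT_comp; first exact: measurable_kS.
  by apply: measurable_funM => //; exact: measurable_funB.
have g0 t : (0 <= k t)%E.
  by rewrite lee_fin mulr_ge0 ?kE1_ge0 ?kS_ge0.
pose h (t : R) := k (r - t).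
have mh : measurable_fun [set: R] h.
  by apply: (measurableT_comp m); exact: measurable_funB.
transitivity (\int[mu]_t h t)%E; first by symmetry; exact: (ge0_integral_rev r k).
transitivity (al%:E * \int[mu]_u h (al * u + 0)%R)%E.
  by symmetry; exact: (ge0_integral_affine al 0 h al0 mh (fun t => g0 (r - t))).
rewrite EFinM; congr (_ * _)%E.
transitivity (\int[mu]_u (kE1 ((r - x) / al - u) * kS u)%:E)%E.
  apply: eq_integral => u _; rewrite /h /k; congr (kE1 _ * kS _)%:E; field; by rewrite gt_eqF.
have [xr|rx] := ltP x r; first by rewrite integral_kE1_kS// divr_gt0// subr_gt0.
apply: integral0_eq => u _.
have [u0|u0] := ltP 0 u; last by rewrite /kS ltNge u0 mulr0.
rewrite /kE1 subr_gt0 ltNge (_ : _ <= u) ?mul0r// (le_trans _ (ltW u0))//.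
by rewrite pmulr_lle0 ?invr_gt0// subr_le0.
Qed.

End kernels.

(** * Fubini *)

Section inversion.
Context {R : realType}.
Notation mu := (@lebesgue_measure R).

(** The null point t = x is dropped because [k0 0] and [k 0] may differ; the extended kernel cuts
    off t < x, the restricted function cuts off t > b, and [a <= x] keeps ]x, b] inside [a, b]. *)
Lemma Rintegral_kernel_restrict (k0 k g : R -> R) (a b al x : R) : 0 < al -> a <= x ->
  measurable_fun [set: R] k -> measurable_fun [set: R] (g \_ `[a, b]) ->
  (forall z, k z = if 0 < z then k0 z else 0) ->
  \int[mu]_(t in `[x, b]) (k0 ((t - x) / al) * g t) =
  \int[mu]_t (k ((t - x) / al) * (g \_ `[a, b]) t).
Proof.
move=> al0 ax mk mg kE; rewrite /Rintegral; congr fine.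
have E t : t \in `]x, b] -> k0 ((t - x) / al) * g t = k ((t - x) / al) * (g \_ `[a, b]) t.
  rewrite in_itv/= => /andP[xt tb].
  by rewrite kE divr_gt0 ?subr_gt0// patchE mem_setE in_itv/= tb (le_trans ax (ltW xt)).
have mkg : measurable_fun [set: R] (fun t => k ((t - x) / al) * (g \_ `[a, b]) t).
  apply: measurable_funM => //; apply: measurableT_comp => //.
  by apply: measurable_funM => //; exact: measurable_funB.
rewrite -integral_itv_obnd_cbnd//; last first.
  apply/measurable_EFinP; apply: eq_measurable_fun (measurable_funTS mkg) => t.
  by rewrite inE => tI; rewrite -E.
rewrite [LHS]integral_mkcond; apply: eq_integral => t _.
rewrite patchE mem_setE; case: ifPn => [tI|]; first by rewrite E.
rewrite in_itv/= negb_and -leNgt -ltNge => /orP[tx|bt].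
  by rewrite kE ltNge pmulr_lle0 ?invr_gt0// subr_le0 tx mul0r.
by rewrite patchE mem_setE in_itv/= [(t <= b)]leNgt bt andbF mulr0.
Qed.

Variables (a b al : R) (f : R -> R).
Hypotheses (hf : L1 a b f) (al0 : 0 < al).
Let ft := f \_ `[a, b].

Let ift : mu.-integrable setT (EFin \o ft).
Proof. by move: hf; rewrite /L1 integrable_mkcond//= restrict_EFin. Qed.

Let mft : measurable_fun [set: R] ft.
Proof. by apply/measurable_EFinP; exact: measurable_int ift. Qed.

Let ft_lty : (\int[mu]_r (`|ft r|)%:E < +oo)%E.
Proof. by have /integrableP[_] := ift. Qed.

Lemma frac_SE t : a <= t -> frac_S b al f t = \int[mu]_r (kS ((r - t) / al) * ft r).
Proof. by move=> at_; apply: Rintegral_kernel_restrict => //; exact: measurable_kS. Qed.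

(** The indicator in t secures integrability on the plane: for a <= t and r <= b the argument (r -
    t)/al stays below (b - a)/al, and [kS] has finite mass up to there. *)
Let K1 (z : R * R) : R := (z.1 \in `[a, b])%:R * (kS ((z.2 - z.1) / al) * ft z.2).

Let mtr d (T : measurableType d) (u v : T -> R) : measurable_fun [set: T] u -> measurable_fun [set: T] v ->
  measurable_fun [set: T] (fun z => (u z - v z) / al).
Proof. by move=> mu' mv; apply: measurable_funM => //; exact: measurable_funB. Qed.

Let mab : measurable_fun [set: R] (fun t : R => (t \in `[a, b])%:R : R).
Proof.
rewrite (_ : (fun t => _) = (fun t => (a <= t)%R%:R * (t <= b)%R%:R)); last first.
  by apply/funext => t; rewrite in_itv/=; case: (a <= t); case: (t <= b); rewrite /= ?mul1r ?mul0r.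
by apply: measurable_funM; apply: measurable_fun_natb; exact: measurable_fun_ler.
Qed.

Let mK1 : measurable_fun [set: R * R] K1.
Proof.
apply: measurable_funM; first exact: (measurableT_comp mab).
apply: measurable_funM; last exact: measurableT_comp.
by apply: measurableT_comp; [exact: measurable_kS|exact: mtr].
Qed.

Let C : \bar R := \int[mu]_u (kS u * (u <= (b - a) / al)%R%:R)%:E.

Let mC : measurable_fun [set: R] (fun u => (kS u * (u <= (b - a) / al)%R%:R)%:E).
Proof.
apply/measurable_EFinP; apply: measurable_funM; first exact: measurable_kS.
by apply: measurable_fun_natb; exact: measurable_fun_ler.
Qed.

Let integral_kS_itv r : r <= b ->
  (\int[mu]_t ((t \in `[a, b])%:R * kS ((r - t) / al))%:E <= al%:E * C)%E.
Proof.
move=> rb.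
pose h u := (kS u * (u <= (b - a) / al)%R%:R)%:E.
have mh : measurable_fun [set: R] h by exact: mC.
have h0 u : (0 <= h u)%E by rewrite lee_fin mulr_ge0 ?kS_ge0.
pose h1 u := h (u / al).
have mh1 : measurable_fun [set: R] h1.
  by apply: measurableT_comp => //; exact: measurable_funM.
have h10 t : (0 <= h1 t)%E by exact: h0.
have CE : (al%:E * C = \int[mu]_t h1 (r - t)%R)%E.
  rewrite (ge0_integral_rev r h1 mh1 h10) -(ge0_integral_affine al 0 h1 al0 mh1 h10).
  congr (_ * _)%E; apply: eq_integral => u _.
  have E : (al * u + 0) / al = u by field; rewrite gt_eqF.
  by rewrite /h1 E.
rewrite CE.
apply: ge0_le_integral => //.
- by move=> t _; rewrite lee_fin mulr_ge0 ?kS_ge0.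
- apply/measurable_EFinP; apply: measurable_funM => //.
  by apply: measurableT_comp; [exact: measurable_kS|exact: mtr].
- by apply: (measurableT_comp mh1); exact: measurable_funB.
- move=> t _; rewrite lee_fin in_itv/=; have [at_|_] := leP a t; last by rewrite mul0r mulr_ge0 ?kS_ge0.
  have [tb|_] := leP t b; last by rewrite mul0r mulr_ge0 ?kS_ge0.
  by rewrite mul1r ler_pM2r ?invr_gt0// lerB// mulr1.
Qed.

(** Integrating in t first gives at most [al * C] uniformly in r <= b, and [ft] vanishes beyond b;
    what remains is a multiple of the L^1 norm of f. *)
Let iK1 : (mu \x mu)%E.-integrable setT (EFin \o K1).
Proof.
apply/integrable21ltyP; first exact/measurable_EFinP.
have C0 : (0 <= al%:E * C)%E.
  apply: mule_ge0; first by rewrite lee_fin ltW.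
  by apply: integral_ge0 => u _; rewrite lee_fin mulr_ge0 ?kS_ge0.
have mft' : measurable_fun [set: R] (fun r => (`|ft r|)%:E).
  by apply/measurable_EFinP; exact: measurableT_comp.
apply: (@le_lt_trans _ _ (\int[mu]_r ((`|ft r|)%:E * (al%:E * C)))%E).
  apply: ge0_le_integral => //.
  - by move=> r _; apply: integral_ge0.
  - apply: (measurable_fun_fubini_tonelli_G (m1 := mu) (fun z => `|(K1 z)%:E|%E)) => //.
    by apply: measurableT_comp => //; exact/measurable_EFinP.
  - by apply: emeasurable_funM.
  - move=> r _.
    have mk : measurable_fun [set: R] (fun t => (t \in `[a, b])%:R * kS ((r - t) / al)).
      by apply: measurable_funM => //; apply: measurableT_comp; [exact: measurable_kS|exact: mtr].
    apply: (@le_trans _ _ (\int[mu]_t (`|ft r| * ((t \in `[a, b])%:R * kS ((r - t) / al)))%:E)%E).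
      rewrite le_eqVlt; apply/orP; left; apply/eqP; apply: eq_integral => t _ /=.
      by rewrite /K1/= !normrM (ger0_norm (kS_ge0 _)) normr_nat; congr EFin; ring.
    rewrite ge0_integral_EFinZl//; last by move=> t _; rewrite mulr_ge0 ?kS_ge0.
    have [rb|br] := leP r b; first by rewrite lee_wpmul2l// integral_kS_itv.
    by rewrite /ft patchE mem_setE in_itv/= [r <= b]leNgt br andbF normr0 !mul0e.
rewrite ge0_integralZr// lte_mul_pinfty//.
- exact: integral_ge0.
- by rewrite ge0_fin_numE// integral_ge0.
- rewrite lte_mul_pinfty ?lee_fin ?ltW//.
  exact: integral_kS_lty.
Qed.

Let F1 t := (\int[mu]_r (K1 (t, r))%:E)%E.

Let iF1 : mu.-integrable setT F1.
Proof. exact: (integrable_fubini_F iK1). Qed.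

Lemma frac_S_restrictE t : (frac_S b al f \_ `[a, b]) t = fine (F1 t).
Proof.
rewrite patchE mem_setE /F1; case: ifPn => tab.
  rewrite frac_SE; last by move: tab; rewrite in_itv/= => /andP[].
  by congr fine; apply: eq_integral => r _; rewrite /K1/= tab mul1r.
by rewrite integral0_eq// => r _; rewrite /K1/= (negbTE tab) mul0r.
Qed.

(** [fine] can only lower absolute values, so integrability passes from [F1]. *)
Lemma integrable_frac_S : mu.-integrable setT (EFin \o (frac_S b al f \_ `[a, b])).
Proof.
have mF1 := measurable_int _ iF1.
apply: le_integrable iF1 => //.
  apply/measurable_EFinP; rewrite (funext frac_S_restrictE).
  by apply: measurableT_comp; first exact: fine_measurable.
move=> t _ /=; rewrite frac_S_restrictE.
by case: (F1 t) => [x| |] //=; exact: leey.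
Qed.

Lemma L1_frac_S : L1 a b (frac_S b al f).
Proof. by rewrite /L1 integrable_mkcond//= restrict_EFin; exact: integrable_frac_S. Qed.

Lemma frac_JE x : a <= x -> frac_J b al (frac_S b al f) x =
  al^-1 * \int[mu]_t (kE1 ((t - x) / al) * (frac_S b al f \_ `[a, b]) t).
Proof.
move=> ax; rewrite /frac_J; congr (_ * _); apply: Rintegral_kernel_restrict => //.
  exact: measurable_kE1.
by apply/measurable_EFinP; exact: measurable_int integrable_frac_S.
Qed.

(** After exchanging the integrals, the Sonine identity collapses the inner one to al times the
    indicator of x < r, and al cancels the prefactor of [frac_J]. *)
Lemma frac_J_frac_SE x : a <= x ->
  frac_J b al (frac_S b al f) x = \int[mu]_r (ft r * (x < r)%R%:R).
Proof.
move=> ax; rewrite frac_JE//.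
pose K2 (z : R * R) : R := kE1 ((z.1 - x) / al) * (kS ((z.2 - z.1) / al) * ft z.2).
have mkE1 : measurable_fun [set: R] (fun t => kE1 ((t - x) / al)).
  by apply: measurableT_comp; [exact: measurable_kE1|exact: mtr].
have mkS r : measurable_fun [set: R] (fun t => kS ((r - t) / al)).
  by apply: measurableT_comp; [exact: measurable_kS|exact: mtr].
have mK2 : measurable_fun [set: R * R] K2.
  apply: measurable_funM; first exact: (measurableT_comp mkE1).
  apply: measurable_funM; last exact: measurableT_comp.
  by apply: measurableT_comp; [exact: measurable_kS|exact: mtr].
have mftx : measurable_fun [set: R] (fun r => ft r * (x < r)%R%:R).
  by apply: measurable_funM => //; apply: measurable_fun_natb; exact: measurable_fun_ltr.
have iftx : mu.-integrable setT (EFin \o (fun r => ft r * (x < r)%R%:R)).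
  apply: le_integrable ift => //; first exact/measurable_EFinP.
  by move=> r _ /=; rewrite lee_fin normrM normr_nat ler_piMr// (ler_nat _ _ 1) leq_b1.
have ikk r : mu.-integrable setT (EFin \o (fun t => kE1 ((t - x) / al) * kS ((r - t) / al))).
  apply/integrableP; split; first by apply/measurable_EFinP; exact: (measurable_funM mkE1 (mkS r)).
  under eq_integral do rewrite gee0_abs ?lee_fin ?mulr_ge0 ?kE1_ge0 ?kS_ge0//.
  by rewrite integral_kE1_kS_scaled// ltry.
have iK2 : (mu \x mu)%E.-integrable setT (EFin \o K2).
  apply/integrable21ltyP; first exact/measurable_EFinP.
  apply: (@le_lt_trans _ _ (\int[mu]_r (al * `|ft r * (x < r)%R%:R|)%:E)%E).
    rewrite le_eqVlt; apply/orP; left; apply/eqP; apply: eq_integral => r _.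
    transitivity (\int[mu]_t (`|ft r| * (kE1 ((t - x) / al) * kS ((r - t) / al)))%:E)%E.
      apply: eq_integral => t _ /=; rewrite /K2/= !normrM (ger0_norm (kS_ge0 _)) (ger0_norm (kE1_ge0 _)).
      by congr EFin; ring.
    rewrite ge0_integral_EFinZl//; last 2 first.
    - exact: (measurable_funM mkE1 (mkS r)).
    - by move=> t _; rewrite mulr_ge0 ?kE1_ge0 ?kS_ge0.
    by rewrite integral_kE1_kS_scaled// -EFinM normrM normr_nat; congr EFin; ring.
  rewrite ge0_integral_EFinZl ?ltW//; last exact: measurableT_comp.
  by rewrite lte_mul_pinfty ?lee_fin ?ltW//; have /integrableP[_] := iftx.
(* Where the section of [K1] at t is integrable, [frac_S] is a genuine integral and [kE1] moves
   inside. [K2] has no indicator of [a, b]: [kE1] vanishes for t <= x, and for t > b either [ft] or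
   [kS] does. *)
have FE : (\int[mu]_t (kE1 ((t - x) / al) * (frac_S b al f \_ `[a, b]) t)%:E =
    \int[mu]_t \int[mu]_r (EFin \o K2) (t, r))%E.
  apply: ae_eq_integral => //.
  - apply/measurable_EFinP; apply: measurable_funM => //.
    by apply/measurable_EFinP; exact: measurable_int integrable_frac_S.
  - exact: (measurable_fubini_F iK2).
  - have := ae_integrable1 iK1; apply: filterS => t it _ /=.
    have [xt|tx] := ltP x t; last first.
      have -> : kE1 ((t - x) / al) = 0.
        by rewrite /kE1 ltNge pmulr_lle0 ?invr_gt0// subr_le0 tx.
      by rewrite mul0r integral0_eq// => r _; rewrite /K2/= /kE1 ltNge pmulr_lle0 ?invr_gt0// subr_le0 tx mul0r.
    have [tb|bt] := leP t b; last first.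
      rewrite patchE mem_setE in_itv/= [t <= b]leNgt bt andbF mulr0 integral0_eq// => r _.
      rewrite /K2/= /ft patchE mem_setE in_itv/=; have [rb|br] := leP r b; last by rewrite andbF !mulr0.
      have rt := ltW (le_lt_trans rb bt).
      by rewrite /kS ltNge pmulr_lle0 ?invr_gt0// subr_le0 rt mul0r mulr0.
    have tab : t \in `[a, b] by rewrite in_itv/= tb (le_trans ax (ltW xt)).
    rewrite frac_S_restrictE EFinM fineK; last exact: (integrable_fin_num _ it).
    rewrite -integralZl//; apply: eq_integral => r _ /=.
    by rewrite /K1 /K2/= tab mul1r.
rewrite /Rintegral FE (Fubini iK2).
transitivity (al^-1 * fine (al%:E * \int[mu]_r (ft r * (x < r)%R%:R)%:E)%E); last first.
  by rewrite fineM//; [rewrite mulKf ?gt_eqF|exact: (integrable_fin_num _ iftx)].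
congr (_ * fine _); rewrite -integralZl//; apply: eq_integral => r _ /=.
transitivity (\int[mu]_t ((ft r)%:E * (kE1 ((t - x) / al) * kS ((r - t) / al))%:E))%E.
  by apply: eq_integral => t _; rewrite -EFinM /K2/=; congr EFin; ring.
rewrite integralZl//; last exact: ikk.
by rewrite integral_kE1_kS_scaled// -!EFinM; congr EFin; ring.
Qed.
End inversion.

(** * Tail integrals and absolutely continuous representatives *)

Section tail_integral.
Context {R : realType}.
Notation mu := (@lebesgue_measure R).
Variable g : R -> R.
Hypothesis ig : mu.-integrable setT (EFin \o g).

Definition tailint (x : R) : R := \int[mu]_r (g r * (x < r)%R%:R).

Let mg : measurable_fun [set: R] g.
Proof. by apply/measurable_EFinP; exact: measurable_int ig. Qed.

Let mgx x : measurable_fun [set: R] (fun r => g r * (x < r)%R%:R).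
Proof. by apply: measurable_funM => //; apply: measurable_fun_natb; exact: measurable_fun_ltr. Qed.

Let igx x : mu.-integrable setT (EFin \o (fun r => g r * (x < r)%R%:R)).
Proof.
apply: le_integrable ig => //; first by apply/measurable_EFinP; exact: mgx.
by move=> r _ /=; rewrite lee_fin normrM normr_nat ler_piMr// (ler_nat _ _ 1) leq_b1.
Qed.

Lemma tailint_dist u v : u <= v ->
  (`|tailint v - tailint u|%:E <= \int[mu]_(r in `]u, v[) `|g r|%:E)%E.
Proof.
move=> uv; rewrite distrC /tailint -RintegralB//.
have id : mu.-integrable setT (EFin \o (fun r => g r * (u < r)%R%:R - g r * (v < r)%R%:R)).
  by apply: (integrableB measurableT (igx u) (igx v)).
apply: (@le_trans _ _ (\int[mu]_r `|g r * (u < r)%R%:R - g r * (v < r)%R%:R|)%:E).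
  by rewrite lee_fin le_normr_Rintegral.
rewrite /Rintegral fineK; last first.
  by apply: integrable_fin_num => //; exact: (integrable_norm id).
rewrite le_eqVlt; apply/orP; left; apply/eqP.
rewrite -(@integral_itv_bndoo _ u v (fun r => `|g r|%:E) false false); last first.
  by apply/measurable_EFinP; apply: measurableT_comp => //; exact: measurable_funTS.
rewrite [RHS]integral_mkcond; apply: eq_integral => r _.
rewrite patchE mem_setE in_itv/=; have [ur|ru] := ltP u r; have [rv|vr] := leP r v => /=.
- by rewrite mulr1 mulr0 subr0.
- by rewrite subrr normr0.
- by rewrite !mulr0 subrr normr0.
- by have := lt_le_trans vr (le_trans ru uv); rewrite ltxx.
Qed.

(** Absolute continuity of the integral of |g| is applied to the union of the intervals, whose
    measure is the sum of their lengths by disjointness. *)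
Lemma tailint_absolutely_continuous a b : absolutely_continuous a b tailint.
Proof.
move=> e e0; have [d [d0 dP]] := integral_normr_continuous ig e0.
exists d => // n u v uv tuv sd.
pose A := \big[setU/set0]_(i < n) `]u i, v i[%classic.
have mA : measurable A by apply: bigsetU_measurable.
have muA : (mu A < d%:E)%E.
  rewrite (measure_bigsetU_ord mu predT)//.
  have muE i : (mu `]u i, v i[ = (v i - u i)%:E)%E.
    rewrite lebesgue_measure_itv/= lte_fin; have [_ [+ _]] := uv i.
    by rewrite le_eqVlt => /orP[/eqP ->|->//]; rewrite ltxx subrr.
  rewrite (eq_bigr (fun i => (v i - u i)%:E)) ?sumEFin ?lte_fin// => i _; exact: muE.
have := dP A mA muA; rewrite -lte_fin fineK; last first.
  apply: integrable_fin_num => //.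
  by apply: (integrableS measurableT) => //; exact: integrable_norm.
move=> h; rewrite -lte_fin; apply: le_lt_trans h.
rewrite ge0_integral_bigsetU//=; last 3 first.
- exact: index_enum_uniq.
- by apply: sub_trivIset tuv.
- by apply/measurable_EFinP; apply: measurableT_comp => //; exact: measurable_funTS.
rewrite -sumEFin; apply: lee_sum => i _.
by apply: tailint_dist; have [_ []] := uv i.
Qed.

(** A tail is a constant minus the primitive from -oo, to which the Lebesgue form of the fundamental
    theorem applies. *)
Lemma tailint_derivable :
  {ae mu, forall x, derivable tailint x 1 /\ derive1 tailint x = - g x}.
Proof.
have iFx (y : R) : mu.-integrable `]-oo, y] (EFin \o g).
  by apply: integrableS ig => //; exact: measurable_itv.
pose F (x : R) := \int[mu]_(t in `]-oo, x]) g t.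
have tE : tailint = cst (\int[mu]_r g r) - F.
  apply/funext => x; rewrite fctE; apply/eqP; rewrite -subr_eq opprK; apply/eqP.
  rewrite /F Rintegral_mkcond /tailint -RintegralD//; first last.
  - by rewrite -restrict_EFin -integrable_mkcond.
  - apply: eq_Rintegral => r _; rewrite patchE mem_setE in_itv/=.
    by case: leP; rewrite ?mulr0 ?mulr1 ?add0r ?addr0.
have := FTC1Ny iFx (open_integrable_locally openT ig).
apply: filterS; first exact: (ae_filter_ringOfSetsType mu).
move=> x [dF F'].
have F'x : 'D_1 F x = g x by rewrite -derive1E; exact: F'.
have isF : is_derive x 1 F (g x) := DeriveDef dF F'x.
have [dt vt] := is_deriveB (is_derive_cst (\int[mu]_r g r) x 1) isF.
by rewrite tE derive1E vt sub0r.
Qed.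

End tail_integral.

(** * Uniqueness of the absolutely continuous representative *)

Section representative.
Context {R : realType}.
Notation mu := (@lebesgue_measure R).

(** Families of a single interval already give uniform continuity. *)
Lemma absolutely_continuous_near (a b : R) (F : R -> R) (e : R) :
  absolutely_continuous a b F -> 0 < e -> exists2 d : R, 0 < d &
    forall x y, a <= x <= b -> a <= y <= b -> `|x - y| < d -> `|F x - F y| < e.
Proof.
move=> acF e0; have [d d0 dP] := acF e e0; exists d => //.
have wlg x y : a <= x -> x <= y -> y <= b -> y - x < d -> `|F y - F x| < e.
  move=> ax xy yb xyd; have := dP 1%N (fun=> x) (fun=> y).
  rewrite !big_ord1; apply => //.
  by move=> i j _ _ _; rewrite !ord1.
move=> x y /andP[ax xb] /andP[ay yb]; have [xy|yx] := leP x y.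
  by rewrite distrC ger0_norm ?subr_ge0// => h; rewrite distrC; exact: wlg.
by rewrite gtr0_norm ?subr_gt0// => h; apply: wlg => //; exact: ltW.
Qed.

(** If the functions differed at x, then by continuity they would differ on a nondegenerate interval
    of [a, b] near x, which has positive measure. *)
Lemma absolutely_continuous_ae_eq (a b : R) (F G : R -> R) : a < b ->
  absolutely_continuous a b F -> absolutely_continuous a b G ->
  ae_on a b (fun x => F x = G x) -> forall x, a <= x <= b -> F x = G x.
Proof.
move=> ab acF acG FG x axb; apply/eqP; apply: contrapT => /negP FGx.
pose e := `|F x - G x| / 2.
have e0 : 0 < e by rewrite divr_gt0// normr_gt0 subr_eq0.
have [d1 d10 d1P] := absolutely_continuous_near _ _ _ _ acF e0.
have [d2 d20 d2P] := absolutely_continuous_near _ _ _ _ acG e0.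
pose d := Num.min d1 d2.
have d0 : 0 < d by rewrite lt_min d10.
(* When x is an endpoint of [a, b] it lies outside ]u, v[, but the interval is still nonempty since
   a < b. *)
pose u := Num.max a (x - d); pose v := Num.min b (x + d).
have /andP[ax xb] := axb.
have uv : u < v.
  by rewrite lt_min !gt_max ab/=; apply/and3P; split; lra.
have [N [mN N0 subN]] := FG.
have IN : `]u, v[ `<=` N.
  move=> y /=; rewrite in_itv/= gt_max lt_min => /andP[/andP[ay dy] /andP[yb yd]].
  apply: subN => /= /(_ _)/wrap[]; first by rewrite in_itv/= !ltW.
  move=> FGy.
  have xyd : `|x - y| < d by rewrite ltr_distlC; lra.
  have ayb : a <= y <= b by rewrite !ltW.
  have := d1P x y axb ayb; have := d2P x y axb ayb.
  move: xyd; rewrite lt_min => /andP[-> ->] /(_ isT) hG /(_ isT) hF.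
  have : `|F x - G x| < e + e.
    rewrite (_ : F x - G x = (F x - F y) - (G x - G y)); last by rewrite FGy; ring.
    by rewrite (le_lt_trans (ler_normB _ _))// ltrD.
  by rewrite /e -mulr2n -[X in _ < X]mulr_natr mulfVK ?ltxx.
have : (mu `]u, v[ <= 0)%E by rewrite -N0 le_measure ?inE.
by rewrite lebesgue_measure_itv/= lte_fin uv -EFinD lee_fin leNgt subr_gt0 uv.
Qed.

End representative.

Theorem theorem4p4 (R : realType) (a b alpha : R) (f : R -> R)
    (hab : a < b) (hf : L1 a b f) (halpha : 0 < alpha) :
  frac_derivable a b alpha (frac_S b alpha f) /\
  ae_on a b (fun x =>
    derivable (ac_repr a b (frac_J b alpha (frac_S b alpha f))) x 1 /\
    frac_deriv a b alpha (frac_S b alpha f) x = - f x).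
Proof.
pose ft := f \_ `[a, b].
have ift : (@lebesgue_measure R).-integrable setT (EFin \o ft).
  by move: hf; rewrite /L1 integrable_mkcond//= restrict_EFin.
set J := frac_J b alpha (frac_S b alpha f).
have JT : is_ac_repr a b J (tailint ft).
  split; first exact: tailint_absolutely_continuous.
  apply: aeW => x; rewrite in_itv/= => /andP[ax _].
  exact: frac_J_frac_SE.
have exT : has_ac_repr a b J by exists (tailint ft).
split; first by split; [exact: L1_frac_S|exact: exT].
have [acG GJ] : is_ac_repr a b J (ac_repr a b J) by exact: (xgetPex J exT).
set G := ac_repr a b J in acG GJ *.
(* The chosen representative is known only up to a null set, which says nothing about derivatives;
   uniqueness gives equality at every point of [a, b]. *)
have GT : forall x, a <= x <= b -> G x = tailint ft x.
  apply: (absolutely_continuous_ae_eq _ _ _ _ hab acG JT.1).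
  rewrite /ae_on in GJ *; have := JT.2; rewrite /ae_on => JT2.
  apply: filterS2 GJ JT2; first exact: (ae_filter_ringOfSetsType (@lebesgue_measure R)).
  by move=> x h1 h2 xab; rewrite -h1// h2.
(* At a and b the two-sided derivative involves values outside [a, b], where the representative is
   undetermined; both points are discarded. *)
have neab (c : R) : {ae (@lebesgue_measure R), forall x : R, x != c}.
  exists [set c]; split => //; first exact: lebesgue_measure_set1.
  by move=> x /= /negP; rewrite negbK => /eqP.
apply: filterS3 (tailint_derivable _ ift) (neab a) (neab b).
  exact: (ae_filter_ringOfSetsType (@lebesgue_measure R)).
move=> x [dT T'] xa xb xab.
have axb : x \in `]a, b[ by move: xab; rewrite !in_itv/= !lt_def xa [b == x]eq_sym xb.
have nGT : \forall y \near x, tailint ft y = G y.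
  near=> y; rewrite GT//.
  have : y \in `]a, b[ by near: y; exact: near_in_itvoo.
  by rewrite in_itv/= => /andP[? ?]; rewrite !ltW.
split.
  exact: (near_eq_derivable nGT dT).
rewrite /frac_deriv -/J -/G derive1E -(near_eq_derive (1 : R^o) nGT) -derive1E T' /ft patchE mem_setE xab.
by [].
Unshelve. all: by end_near. Qed.
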